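(* Let $p\in[1,\infty)$. The $p$-Choquet decomposable hull of a nonempty convex subset of $L^p(E)$ is a Choquet set in $V=L^p(E)$. Moreover, for every nonempty $A\subseteq L^p(E)$, \[ \operatorname{chd}_p\operatorname{ch}A=\operatorname{chd}_p\operatorname{conv}A=L^p(\overline{\operatorname{conv}}F_A)=\overline{\operatorname{conv}}\,L^p(F_A)=\overline{\operatorname{conv}}\operatorname{chd}_pA=\operatorname{cl}_p\operatorname{conv}\operatorname{dec}A=\operatorname{cl}_p\operatorname{dec}\operatorname{conv}A . \]
   Context: $E$ is a separable Banach space with dual $E^*$; $(\Omega,\mathcal F,\mathbb P)$ a complete probability space; $L^p(E)$ the Banach space of a.s.-classes of $E$-valued random variables with $\mathbb E|\xi|^p<\infty$. $\operatorname{cl}_p$ is norm closure in $L^p(E)$; $\overline{\operatorname{conv}}B=\operatorname{cl}_p\operatorname{conv}B$ for $B\subseteq L^p(E)$, while for a multifunction $X$, $\overline{\operatorname{conv}}X$ is the pointwise closed convex hull $\omega\mapsto\overline{\operatorname{conv}}X(\omega)$. $\operatorname{dec}A$: all finite decompositions $\sum_{i=1}^m1_{B_i}\xi_i$, $\xi_i\in A$, $(B_i)$ a measurable partition of $\Omega$. $L^p(X)=\{\xi\in L^p(E):\xi(\omega)\in X(\omega)\text{ a.s.}\}$. For nonempty $A\subseteq L^p(E)$, $F_A$ is the a.s. unique closed Effros measurable multifunction with $\operatorname{cl}_p\operatorname{dec}A=L^p(F_A)$. Kernels: a transition probability kernel $K$ from $(\Omega,\mathcal F)$ to $(E,\mathcal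 B(E))$ has barycenter $r(K)=Y\in L^p(E)$ if $L\circ Y=\int_EL(x)K(\cdot,dx)$ a.s. for all $L\in E^*$; $\mathcal K^\delta_p(A)$ is the set of regular Borel transition probability kernels $K$ with $K(\omega,F_A(\omega))=1$ a.s., having barycenter in $L^p(E)$, and $K(\omega)$ Dirac a.s.; $B$ is $p$-Choquet decomposable if $r(K)\in B$ for all $K\in\mathcal K^\delta_p(B)$; $\operatorname{chd}_pA$ is the smallest $p$-Choquet decomposable subset of $L^p(E)$ containing $A$. Choquet hull in $V=L^p(E)$: a Borel probability measure $\mu$ on $V$ has barycenter $r(\mu)=y$ if $\ell(y)=\int_V\ell\,d\mu$ for all $\ell\in V^*$; $\mathcal M(B)$ (for Borel $B$) is the set of regular Borel probability measures with $\mu(B)=1$ having a barycenter, and for arbitrary $B$, $\mathcal M(B)=\bigcup\{\mathcal M(C):C\subseteq B\text{ Borel}\}$; $B$ is a Choquet set if $r(\mu)\in B$ for all $\mu\in\mathcal M(B)$; $\operatorname{ch}B$ is the smallest Choquet set containing $B$. *)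

(* Defs.v *)
From HB Require Import structures.
From mathcomp Require Import all_boot all_order all_algebra.
From mathcomp Require Import all_classical all_reals all_analysis measurable_realfun.
Import Order.TTheory GRing.Theory Num.Theory.
Import numFieldNormedType.Exports.

Set Implicit Arguments.
Unset Strict Implicit.
Unset Printing Implicit Defensive.

Local Open Scope classical_set_scope.
Local Open Scope ring_scope.

Definition convS (R : realType) (T : lmodType R) (B : set T) : set T :=
  [set x | exists (n : nat) (l : 'I_n -> R) (y : 'I_n -> T),
     [/\ (forall i, 0 <= l i), \sum_(i < n) l i = 1,
         (forall i, B (y i)) & x = \sum_(i < n) l i *: y i]].

Definition convexS (R : realType) (T : lmodType R) (B : set T) : Prop :=
  forall x y (t : R), B x -> B y -> 0 <= t <= 1 -> B (t *: x + (1 - t) *: y).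

Definition separable (R : realType) (E : normedModType R) : Prop :=
  exists D : nat -> E, forall (x : E) (e : R), 0 < e ->
    exists n, `|x - D n| < e.

Definition cconvE (R : realType) (E : normedModType R) (S : set E) : set E :=
  closure (convS S).

Definition isdual (R : realType) (E : normedModType R) (L : E -> R) : Prop :=
  (forall (a : R) (x y : E), L (a *: x + y) = a * L x + L y) /\ continuous L.

Definition EB (R : realType) (E : normedModType R) := g_sigma_algebraType (@open E).

Section Lp.
Variables (R : realType) (E : normedModType R) (d : measure_display)
  (Omega : measurableType d) (P : probability Omega R) (p : R).

Definition Emeas (xi : Omega -> E) : Prop :=
  forall U : set E, open U -> measurable (xi @^-1` U).

Definition Lpnormp (xi : Omega -> E) : \bar R :=
  (\int[P]_w ((`|xi w| `^ p)%:E))%E.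

(* L^p(E), represented by (all representatives of) its a.s.-classes *)
Definition Lp : set (Omega -> E) :=
  [set xi | Emeas xi /\ (Lpnormp xi < +oo)%E].

(* (p-th power of the) L^p distance *)
Definition Lpd (xi eta : Omega -> E) : \bar R := Lpnormp (fun w => xi w - eta w).

(* A subset of L^p(E) (a set of a.s.-classes) is represented by the
   saturated set of all its representatives. *)
Definition saturated (B : set (Omega -> E)) : Prop :=
  B `<=` Lp /\
  forall xi eta, B xi -> Lp eta -> {ae P, forall w, xi w = eta w} -> B eta.

Definition clp (B : set (Omega -> E)) : set (Omega -> E) :=
  [set eta | Lp eta /\ forall e : R, 0 < e -> exists2 xi, B xi & (Lpd xi eta < e%:E)%E].

Definition dec (B : set (Omega -> E)) : set (Omega -> E) :=
  [set eta | exists (m : nat) (Bs : 'I_m -> set Omega) (xi : 'I_m -> Omega -> E),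
     [/\ (forall i, measurable (Bs i)),
         (forall i j, i != j -> Bs i `&` Bs j = set0),
         (forall w, exists i, Bs i w),
         (forall i, B (xi i)) &
         eta = (fun w => \sum_(i < m) (\1_(Bs i) w) *: xi i w)]].

Definition closed_valued (X : Omega -> set E) : Prop := forall w, closed (X w).

Definition effros (X : Omega -> set E) : Prop :=
  forall U : set E, open U -> measurable [set w | X w `&` U !=set0].

Definition LpX (X : Omega -> set E) : set (Omega -> E) :=
  [set xi | Lp xi /\ {ae P, forall w, X w (xi w)}].

Definition isFA (A : set (Omega -> E)) (F : Omega -> set E) : Prop :=
  [/\ closed_valued F, effros F & clp (dec A) = LpX F].

Definition radonE (m : probability (EB E) R) : Prop :=
  forall B : set (EB E), measurable B ->
    m B = ereal_sup [set m K | K in [set K : set (EB E) |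
                                       compact (K : set E) /\ K `<=` B]].

Definition rkernel (K : Omega -> probability (EB E) R) : Prop :=
  (forall B : set (EB E), measurable B -> measurable_fun [set: Omega] (fun w : Omega => (K w B : \bar R))) /\
  (forall w, radonE (K w)).

Definition isdirac (m : probability (EB E) R) : Prop :=
  exists x : E, forall B : set (EB E), measurable B -> m B = (\1_B x)%:E.

Definition kbary (K : Omega -> probability (EB E) R) (Y : Omega -> E) : Prop :=
  forall L : E -> R, isdual L ->
    {ae P, forall w, (K w).-integrable setT (fun x : EB E => (L x)%:E) /\
                     (L (Y w))%:E = (\int[K w]_x (L x)%:E)%E}.

Definition Kdelta (B : set (Omega -> E)) (K : Omega -> probability (EB E) R) : Prop :=
  [/\ rkernel K,
      (exists F, isFA B F /\ {ae P, forall w, K w (F w : set (EB E)) = 1%E}),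
      (exists Y, Lp Y /\ kbary K Y) &
      {ae P, forall w, isdirac (K w)}].

Definition pChoquetDec (B : set (Omega -> E)) : Prop :=
  forall K, Kdelta B K -> forall Y, Lp Y -> kbary K Y -> B Y.

Definition chd (A : set (Omega -> E)) : set (Omega -> E) :=
  [set xi | forall B, saturated B -> A `<=` B -> pChoquetDec B -> B xi].

Definition Vopen (O : set (Omega -> E)) : Prop :=
  O `<=` Lp /\ forall xi, O xi -> exists r : R, 0 < r /\
     forall eta, Lp eta -> (Lpd xi eta < r%:E)%E -> O eta.

Definition VB := g_sigma_algebraType Vopen.

Definition Vcompact (K : set (Omega -> E)) : Prop :=
  K `<=` Lp /\
  forall (I : Type) (O : I -> set (Omega -> E)), (forall i, Vopen (O i)) ->
    K `<=` \bigcup_i O i -> exists (n : nat) (f : 'I_n -> I), K `<=` \bigcup_j O (f j).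

Definition Vregular (mu : probability VB R) : Prop :=
  forall B : set VB, measurable B ->
    mu B = ereal_sup [set mu K | K in [set K : set VB |
                        [/\ measurable K, Vcompact K & K `<=` B]]].

Definition Vdual (l : (Omega -> E) -> R) : Prop :=
  (forall (a : R) xi eta, Lp xi -> Lp eta -> l (a *: xi + eta) = a * l xi + l eta) /\
  (forall xi, Lp xi -> forall e : R, 0 < e -> exists2 del : R, 0 < del &
      forall eta, Lp eta -> (Lpd xi eta < del%:E)%E -> `|l eta - l xi| < e).

Definition Vbary (mu : probability VB R) (y : Omega -> E) : Prop :=
  Lp y /\ forall l, Vdual l ->
    mu.-integrable (Lp : set VB) (fun xi => (l xi)%:E) /\
    (\int[mu]_(xi in (Lp : set VB)) (l xi)%:E)%E = (l y)%:E.

Definition MB (B : set (Omega -> E)) (mu : probability VB R) : Prop :=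
  exists C : set VB, [/\ measurable C, C `<=` B, Vregular mu, mu C = 1%E &
                        exists y, Vbary mu y].

Definition Choquet (B : set (Omega -> E)) : Prop :=
  forall mu, MB B mu -> forall y, Vbary mu y -> B y.

Definition ch (A : set (Omega -> E)) : set (Omega -> E) :=
  [set xi | forall B, saturated B -> A `<=` B -> Choquet B -> B xi].

End Lp.

(* Main.v *)
Require Import Defs.
From HB Require Import structures.
From mathcomp Require Import all_boot all_order all_algebra.
From mathcomp Require Import all_classical all_reals all_analysis measurable_realfun.
From mathcomp Require Import lra.
Import Order.TTheory GRing.Theory Num.Theory.
Import numFieldNormedType.Exports.
Local Open Scope classical_set_scope.
Local Open Scope ring_scope.

(** Every Dirac kernel with barycenter [Y] is [w |-> dirac (Y w)], because
    countably many functionals separate the points of [E]; hence a set is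
    p-Choquet decomposable iff it contains [L^p(F_B)], and
    [chd A = cl_p (dec A)] for nonempty [A] (existence of [F_B] is the
    Hiai-Umegaki theorem).  For convex [C] this is a closed convex set, so it is
    a Choquet set by Hahn-Banach separation in [L^p(E)]; conversely Choquet sets
    are convex, as two-point measures show, whence
    [chd (ch A) = chd (conv A)].  Finally [cl_p (conv (L^p(F)))] is closed and
    decomposable, so it is [L^p(G)] for some [G]; measurable selections of [F]
    give [F <= G] a.s., and [G] is a.s. convex-valued, so that
    [cconv F <= G] a.s. *)

Set Implicit Arguments.
Unset Strict Implicit.
Unset Printing Implicit Defensive.

(** * Hahn-Banach separation by minimal sublinear functionals *)

(** [L^p(E)] occurs as a predicate on functions, not as a type of classes, and this shapes several
    choices. Separation is proved on a subset [D] closed under linear combinations, for a seminorm,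
    and rests on a minimal sublinear functional, so that no functional has to be extended from a
    subspace. Distances are p-th powers, hence obey the triangle inequality only up to the factor
    2^p; closure arguments work with radii divided by 2 * 2^p, and the genuine seminorm serves the
    separation alone. A single function need not be a Borel set of the space of representatives, but
    its class is, so the two-point measures are tested on classes.

    Almost-sure inclusions between closed-valued multifunctions cannot be checked point by point,
    since uncountably many null sets would accumulate. They are reduced to countably many tests: a
    ball of radius 1/(k+1) around a dense point [D n] meets one set while all terms of a sequence
    dense in the other stay a fixed multiple of the radius away. Each test fails almost surely. *)

Section sublinear_domination.
Variables (R : realType) (V : lmodType R) (D : set V).

Definition subspace : Prop :=
  D 0 /\ forall (a : R) x y, D x -> D y -> D (a *: x + y).

(** Homogeneity is an inequality for positive scalars because this form passes easily to infima;
    applying it to [a^-1] recovers equality in [sublinear_scale]. *)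
Definition sublinear (q : V -> R) : Prop :=
  (forall x y, D x -> D y -> q (x + y) <= q x + q y) /\
  (forall (a : R) x, D x -> 0 < a -> q (a *: x) <= a * q x).

Definition linear_on (f : V -> R) : Prop :=
  forall (a : R) x y, D x -> D y -> f (a *: x + y) = a * f x + f y.

Hypothesis subD : subspace.

Lemma subspaceD x y : D x -> D y -> D (x + y).
Proof. by move=> Dx Dy; rewrite -[x]scale1r; apply: subD.2. Qed.

Lemma subspaceZ a x : D x -> D (a *: x).
Proof. by move=> Dx; rewrite -[_ *: _]addr0; apply: subD.2 => //; exact: subD.1. Qed.

Lemma subspaceN x : D x -> D (- x).
Proof. by move=> Dx; rewrite -scaleN1r; exact: subspaceZ. Qed.

Lemma subspaceB x y : D x -> D y -> D (x - y).
Proof. by move=> Dx Dy; apply: subspaceD => //; exact: subspaceN. Qed.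

Lemma sublinear0 q : sublinear q -> q 0 = 0.
Proof.
move=> [qD qZ]; have D0 := subD.1; apply/eqP; rewrite eq_le; apply/andP; split.
- have := qZ 2^-1 0 D0; rewrite scaler0 => /(_ ltac:(by rewrite invr_gt0)) h.
  lra.
- by have := qD _ _ D0 D0; rewrite addr0 => h; lra.
Qed.

Lemma sublinear_opp q x : sublinear q -> D x -> - q (- x) <= q x.
Proof.
move=> qs Dx; have := qs.1 _ _ Dx (subspaceN Dx).
by rewrite subrr sublinear0//; lra.
Qed.

Lemma sublinear_scale q a x : sublinear q -> D x -> 0 <= a -> q (a *: x) = a * q x.
Proof.
move=> qs Dx; rewrite le_eqVlt => /orP[/eqP<-|a0].
  by rewrite scale0r mul0r sublinear0.
apply/eqP; rewrite eq_le qs.2//=.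
have := qs.2 a^-1 (a *: x) (subspaceZ a Dx); rewrite invr_gt0 => /(_ a0).
rewrite scalerA mulVf ?gt_eqF// scale1r => h.
by rewrite -ler_pdivlMl.
Qed.

(* the witness lowers [m] along the direction [a]; minimality of [m] among
   sublinear functionals then forces additivity *)
Lemma sublinear_lower m a : sublinear m -> D a ->
  exists2 s, sublinear s &
    (forall x, D x -> s x <= m x) /\ (forall x, D x -> s x <= m (x + a) - m a).
Proof.
move=> ms Da.
(* [t = 0] will give the bound by [m x], [t = 1] the bound by [m (x + a) - m a]. *)
pose S x := [set m (x + t *: a) - t * m a | t in [set t : R | 0 <= t]].
have Slb x : D x -> lbound (S x) (- m (- x)).
  move=> Dx _ [t /= t0 <-].
  have := ms.1 _ _ (subspaceD Dx (subspaceZ t Da)) (subspaceN Dx).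
  by rewrite [x + _]addrC addrK (sublinear_scale ms Da t0); lra.
have Sin x t : 0 <= t -> S x (m (x + t *: a) - t * m a) by move=> t0; exists t.
have Sn x : S x !=set0 by exists (m (x + 0 *: a) - 0 * m a); exact: Sin.
have Sle x t : D x -> 0 <= t -> inf (S x) <= m (x + t *: a) - t * m a.
  by move=> Dx t0; apply: ge_inf; [exists (- m (- x)); exact: Slb|exact: Sin].
exists (fun x => inf (S x)).
  split.
  - move=> x y Dx Dy.
    have Dxy := subspaceD Dx Dy.
    rewrite -lerBlDr; apply: lb_le_inf => // _ [t /= t0 <-].
    rewrite lerBlDr -lerBlDl; apply: lb_le_inf => // _ [u /= u0 <-].
    have tu0 : 0 <= t + u by rewrite addr_ge0.
    have h1 := Sle _ _ Dxy tu0.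
    have := ms.1 _ _ (subspaceD Dx (subspaceZ t Da)) (subspaceD Dy (subspaceZ u Da)).
    rewrite addrACA -scalerDl => h2; lra.
  - move=> c x Dx c0.
    rewrite -ler_pdivrMl//; apply: lb_le_inf => // _ [t /= t0 <-].
    rewrite ler_pdivrMl//.
    have ct0 : 0 <= c * t by rewrite mulr_ge0// ltW.
    apply: (le_trans (Sle _ _ (subspaceZ c Dx) ct0)).
    have := ms.2 c _ (subspaceD Dx (subspaceZ t Da)) c0.
    rewrite scalerDr scalerA => h; lra.
split=> x Dx.
- by have := Sle x 0 Dx (lexx 0); rewrite scale0r addr0 mul0r subr0.
- by have := Sle x 1 Dx ler01; rewrite scale1r mul1r.
Qed.

(** Infima preserve subadditivity along a chain because two members can be replaced by the smaller
    one. The value [- q (- x)] bounds every member from below. *)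
Lemma sublinear_chain_inf (A : set (V -> R)) q : sublinear q ->
  A !=set0 ->
  (forall s, A s -> sublinear s /\ forall x, D x -> s x <= q x) ->
  (forall s t, A s -> A t ->
    (forall x, D x -> s x <= t x) \/ (forall x, D x -> t x <= s x)) ->
  exists2 m, sublinear m & forall s, A s -> forall x, D x -> m x <= s x.
Proof.
move=> qs [s0 As0] As tot.
pose S x := [set s x | s in A].
have Slb x : D x -> lbound (S x) (- q (- x)).
  move=> Dx _ [s sA <-]; have [ss sq] := As _ sA.
  apply: le_trans (sublinear_opp ss Dx); rewrite lerN2.
  exact/sq/subspaceN.
have Sn x : S x !=set0 by exists (s0 x), s0.
have Sle x s : D x -> A s -> inf (S x) <= s x.
  by move=> Dx sA; apply: ge_inf; [exists (- q (- x)); exact: Slb|exists s].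
exists (fun x => inf (S x)); last by move=> s sA x Dx; exact: Sle.
split.
- move=> x y Dx Dy; have Dxy := subspaceD Dx Dy.
  rewrite -lerBlDr; apply: lb_le_inf => // _ [s sA <-].
  rewrite lerBlDr -lerBlDl; apply: lb_le_inf => // _ [t tA <-].
  rewrite lerBlDl.
  have [st|ts] := tot _ _ sA tA.
  + have := (As _ sA).1.1 _ _ Dx Dy; have := Sle _ _ Dxy sA; have := st _ Dy; lra.
  + have := (As _ tA).1.1 _ _ Dx Dy; have := Sle _ _ Dxy tA; have := ts _ Dx; lra.
- move=> c x Dx c0.
  rewrite -ler_pdivrMl//; apply: lb_le_inf => // _ [s sA <-].
  rewrite ler_pdivrMl//.
  exact: le_trans (Sle _ _ (subspaceZ c Dx) sA) ((As _ sA).1.2 _ _ Dx c0).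
Qed.

Lemma sublinear_dominates_linear q : sublinear q ->
  exists2 f, linear_on f & forall x, D x -> f x <= q x.
Proof.
move=> qs.
pose T := {m : V -> R | sublinear m /\ forall x, D x -> m x <= q x}.
have t0 : T by exists q; split => // x _; exact: lexx.
(* The order is reversed: Zorn's lemma yields maximal elements and a minimal functional is wanted.
   The empty chain is bounded by [q] itself. *)
pose r (s t : T) := `[< forall x, D x -> sval t x <= sval s x >].
have [|||[m [ms mq]] mmax] := @ZL_preorder T t0 r.
- by move=> t; apply/asboolP => x _; exact: lexx.
- move=> s t u /asboolP st /asboolP tu; apply/asboolP => x Dx.
  exact: le_trans (tu _ Dx) (st _ Dx).
- move=> A totA.
  have [[u uA]|A0] := pselect (A !=set0); last first.
    by exists t0 => s sA; exfalso; apply: A0; exists s.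
  have An : [set sval t | t in A] !=set0 by exists (sval u), u.
  have Aq s : [set sval t | t in A] s -> sublinear s /\ forall x, D x -> s x <= q x.
    by move=> [[t tp] tA <-].
  have [s t [s' sA <-] [t' tA <-]|m ms mA] := sublinear_chain_inf qs An Aq.
    by have [/asboolP|/asboolP] := totA _ _ sA tA; [right|left].
  have mq : forall x, D x -> m x <= q x.
    move=> x Dx; have uS : [set sval t | t in A] (sval u) by exists u.
    exact: le_trans (mA _ uS _ Dx) ((Aq _ uS).2 _ Dx).
  exists (exist _ m (conj ms mq)) => s sA; apply/asboolP => x Dx /=.
  by apply: mA => //; exists s.
have madd x a : D x -> D a -> m (x + a) = m x + m a.
  move=> Dx Da; apply/eqP; rewrite eq_le ms.1//= -lerBrDr.
  have [s ss [sm sa]] := sublinear_lower ms Da.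
  apply: le_trans (sa _ Dx).
  have sq : forall x, D x -> s x <= q x.
    by move=> z Dz; exact: le_trans (sm _ Dz) (mq _ Dz).
  have := mmax (exist _ s (conj ss sq)).
  by move=> /(_ ltac:(by apply/asboolP))/asboolP/(_ _ Dx).
exists m => // a x y Dx Dy.
rewrite madd//; last exact: subspaceZ.
congr (_ + _).
have [a0|a0] := leP 0 a; first exact: sublinear_scale.
have : m (a *: x) + m (- a *: x) = 0.
  rewrite -madd; [|exact: subspaceZ..].
  by rewrite -scalerDl subrr scale0r sublinear0.
have := @sublinear_scale m (- a) x ms Dx.
by rewrite oppr_ge0 ltW// => /(_ isT) ->; lra.
Qed.

(* The sublinear functional is
   [q v = inf { N (v - t (b - y)) - t delta | t >= 0, b in B }]. *)
Lemma seminorm_separation (N : V -> R) (B : set V) (y : V) (delta : R) :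
  (forall v w, D v -> D w -> N (v + w) <= N v + N w) ->
  (forall a v, D v -> N (a *: v) = `|a| * N v) ->
  B `<=` D -> B !=set0 -> convexS B -> D y ->
  (forall b, B b -> delta <= N (b - y)) ->
  exists f, [/\ linear_on f, forall v, D v -> f v <= N v &
    forall b, B b -> f (b - y) <= - delta].
Proof.
move=> ND NZ BD [b0 Bb0] cB Dy dN.
have NN v : D v -> N (- v) = N v.
  by move=> Dv; rewrite -scaleN1r NZ// normrN1 mul1r.
have N0 : N 0 = 0 by rewrite -(scale0r 0) NZ ?normr0 ?mul0r//; exact: subD.1.
pose S v := [set N (v - z.1 *: (z.2 - y)) - z.1 * delta |
              z in [set z : R * V | 0 <= z.1 /\ B z.2]].
have DB b : B b -> D (b - y) by move=> /BD Db; exact: subspaceB.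
(* The distance bound [delta <= N (b - y)] is what keeps the infimum finite. *)
have Slb v : D v -> lbound (S v) (- N v).
  move=> Dv _ [[t b] /= [t0 Bb] <-].
  have Dt := subspaceZ t (DB _ Bb).
  have := ND _ _ (subspaceB Dv Dt) (subspaceN Dv).
  rewrite NN// [v - _]addrC addrK NN// NZ; last exact: DB.
  rewrite ger0_norm//.
  have := ler_wpM2l t0 (dN _ Bb); lra.
have Sn v : S v !=set0.
  by exists (N (v - 0 *: (b0 - y)) - 0 * delta), (0, b0).
have Sle v t b : D v -> 0 <= t -> B b ->
    inf (S v) <= N (v - t *: (b - y)) - t * delta.
  by move=> Dv t0 Bb; apply: ge_inf; [exists (- N v); exact: Slb|exists (t, b)].
have qs : sublinear (fun v => inf (S v)).
  split.
  - move=> v w Dv Dw; have Dvw := subspaceD Dv Dw.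
    rewrite -lerBlDr; apply: lb_le_inf => // _ [[t b] /= [t0 Bb] <-].
    rewrite lerBlDr -lerBlDl; apply: lb_le_inf => // _ [[u c] /= [u0 Bc] <-].
    rewrite lerBlDl.
    (* Two pairs [(t, b)] and [(u, c)] merge into [(t + u, e)], with [e] the weighted mean of [b]
       and [c]; convexity of [B] enters here. *)
    have [e [Be tue]] : exists e, B e /\
        (t + u) *: (e - y) = t *: (b - y) + u *: (c - y).
      have [tu0|tu0] := eqVneq (t + u) 0.
        have -> : t = 0 by lra.
        have -> : u = 0 by lra.
        by exists b; rewrite addr0 !scale0r addr0.
      exists ((t / (t + u)) *: b + (1 - t / (t + u)) *: c); split.
        apply: cB => //; apply/andP; split; first by rewrite divr_ge0// addr_ge0.
        by rewrite ler_pdivrMr ?mul1r ?lerDl// lt_neqAle eq_sym tu0 addr_ge0.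
      rewrite !scalerBr scalerDr !scalerA.
      have -> : (t + u) * (t / (t + u)) = t by rewrite mulrC divfK.
      have -> : (t + u) * (1 - t / (t + u)) = u.
        by rewrite mulrBr mulr1 mulrC divfK// addrAC subrr add0r.
      by rewrite scalerDl opprD addrACA.
    have tu0 : 0 <= t + u by rewrite addr_ge0.
    apply: (le_trans (Sle _ _ _ Dvw tu0 Be)).
    rewrite tue opprD addrACA.
    have := ND _ _ (subspaceB Dv (subspaceZ t (DB _ Bb)))
                   (subspaceB Dw (subspaceZ u (DB _ Bc))).
    lra.
  - move=> c v Dv c0.
    rewrite -ler_pdivrMl//; apply: lb_le_inf => // _ [[t b] /= [t0 Bb] <-].
    rewrite ler_pdivrMl//.
    have ct0 : 0 <= c * t by rewrite mulr_ge0// ltW.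
    apply: (le_trans (Sle _ _ _ (subspaceZ c Dv) ct0 Bb)).
    rewrite -scalerA -scalerBr NZ.
      by rewrite gtr0_norm//; lra.
    by apply: subspaceB => //; exact/subspaceZ/DB.
(* The pair with [t = 0] bounds [f] by [N]; the pair [(1, b)] at [v = b - y] leaves
   [N 0 - delta]. *)
have [f flin fq] := sublinear_dominates_linear qs.
exists f; split => //.
- move=> v Dv; apply: le_trans (fq _ Dv) _.
  by have := Sle v 0 b0 Dv (lexx _) Bb0; rewrite scale0r mul0r !subr0.
- move=> b Bb; apply: le_trans (fq _ (DB _ Bb)) _.
  by have := Sle _ 1 b (DB _ Bb) ler01 Bb; rewrite scale1r mul1r subrr N0 sub0r.
Qed.

End sublinear_domination.

(** * Dual functionals and measurability in separable spaces *)

Section dual.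
Variables (R : realType) (E : normedModType R).

(** Separating the origin from [x] at distance |x| gives [f (- x)] at most -|x|, and the bound of
    [f] by the norm then fixes [f x]. *)
Lemma norming_functional (x : E) :
  exists L, [/\ isdual L, L x = `|x| & forall v, `|L v| <= `|v|].
Proof.
have [||||||||f [flin fN fx]] :=
    @seminorm_separation R E setT _ (fun v : E => `|v|) [set 0] x `|x|.
- by split.
- by move=> v w _ _; exact: ler_normD.
- by move=> a v _; rewrite normrZ.
- by [].
- by exists 0.
- by move=> y z t -> -> _; rewrite !scaler0 addr0.
- by [].
- by move=> b ->; rewrite sub0r normrN.
have flinT a u v : f (a *: u + v) = a * f u + f v by exact: flin.
have f0 : f 0 = 0.
  by have := flinT 1 0 0; rewrite scaler0 addr0 mul1r; lra.
have fopp v : f (- v) = - f v.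
  by have := flinT (-1) v 0; rewrite f0 !addr0 scaleN1r mulN1r.
have fabs v : `|f v| <= `|v|.
  rewrite ler_norml fN// andbT lerNl -fopp.
  by apply: le_trans (fN _ I) _; rewrite normrN.
exists f; split => //.
- split=> // v; apply/cvgrPdist_lt => e e0; near=> w.
  have -> : f v - f w = f (v - w).
    by have := flinT 1 v (- w); rewrite scale1r mul1r fopp => ->.
  apply: le_lt_trans (fabs _) _; near: w.
  exact: cvgr_dist_lt.
- apply/eqP; rewrite eq_le fN//=.
  have := fx 0 erefl; rewrite sub0r fopp; lra.
Unshelve. all: by end_near. Qed.

(** Norming functionals of a dense sequence suffice: if [D n] is within |v|/2 of [v] and
    [L n v = 0], then |D n| = L n (D n - v) is below |v|/2, which contradicts the triangle
    inequality for [v]. *)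
Lemma dual_separating : separable E ->
  exists L : nat -> E -> R, (forall n, isdual (L n)) /\
    forall v, (forall n, L n v = 0) -> v = 0.
Proof.
move=> [D dD].
have /choice[L hL] : forall n, exists L,
    [/\ isdual L, L (D n) = `|D n| & forall v, `|L v| <= `|v|].
  by move=> n; exact: norming_functional.
exists L; split => [n|v Lv]; first by have [] := hL n.
apply/eqP; rewrite -normr_le0 leNgt; apply/negP => v0.
have e0 : 0 < `|v| / 2 by rewrite divr_gt0.
have [n vDn] := dD v _ e0.
have [[Llin _] LD Lle] := hL n.
have := Lle (D n - v).
have -> : L n (D n - v) = `|D n|.
  have := Llin (-1) v (D n).
  by rewrite scaleN1r addrC => ->; rewrite Lv mulr0 add0r.
rewrite normr_id distrC => h.
have := ler_normD (v - D n) (D n); rewrite subrK.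
by move=> h2; lra.
Qed.

End dual.

(** * Norm neighbourhoods and countable quantifiers over measurable sets *)

Lemma invS_lt (R : realType) (e : R) : 0 < e -> exists k : nat, k.+1%:R^-1 < e.
Proof.
move=> e0; exists (Num.bound e^-1).
have ie0 : 0 <= e^-1 by rewrite invr_ge0 ltW.
rewrite -[ltRHS]invrK ltf_pV2 ?posrE ?invr_gt0//.
by rewrite (lt_trans (archi_boundP ie0))// ltr_nat.
Qed.

Lemma open_norm (R : realType) (E : normedModType R) (U : set E) x :
  open U -> U x -> exists2 e, 0 < e & forall y, `|x - y| < e -> U y.
Proof.
move=> oU Ux; have /nbhs_ballP[e e0 eU] := open_nbhs_nbhs (conj oU Ux).
by exists e => // y xy; apply: eU; rewrite -ball_normE.
Qed.

Lemma closure_norm (R : realType) (E : normedModType R) (U : set E) x :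
  closure U x <-> forall e, 0 < e -> exists2 y, U y & `|x - y| < e.
Proof.
split=> [Ux e e0|Ux B /nbhs_ballP[e /= e0 eB]].
  have /Ux[y [Uy]] := nbhsx_ballx x _ e0.
  by rewrite -ball_normE => xy; exists y.
have [y Uy xy] := Ux _ e0.
by exists y; split => //; apply: eB; rewrite -ball_normE.
Qed.

Section measurable_sets.
Context d (Omega : measurableType d).

Lemma measurable_exists (Q : nat -> Omega -> Prop) :
  (forall n, measurable [set w | Q n w]) -> measurable [set w | exists n, Q n w].
Proof.
move=> mQ; rewrite (_ : [set _ | _] = \bigcup_n [set w | Q n w]).
  exact: bigcupT_measurable.
by apply/seteqP; split=> w /= [n]; [exists n|move=> _; exists n].
Qed.

Lemma measurable_forall (Q : nat -> Omega -> Prop) :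
  (forall n, measurable [set w | Q n w]) -> measurable [set w | forall n, Q n w].
Proof.
move=> mQ; rewrite (_ : [set _ | _] = \bigcap_n [set w | Q n w]).
  exact: bigcapT_measurable.
by apply/seteqP; split=> w /= h n; [move=> _|]; exact: h.
Qed.

Lemma measurable_and_cst (C : Prop) (Q : set Omega) :
  measurable Q -> measurable [set w | C /\ Q w].
Proof.
move=> mQ; have [c|c] := pselect C.
  by rewrite (_ : [set _ | _] = Q)//; apply/seteqP; split=> w //= [].
by rewrite (_ : [set _ | _] = set0)//; apply/seteqP; split=> w //= [].
Qed.

End measurable_sets.

(** * Two-piece gluing and measurability of functions with values in [E] *)

Definition splice (T : Type) (V : Type) (B : set T) (x y : T -> V) : T -> V :=
  fun w => if w \in B then x w else y w.

Lemma spliceT (T V : Type) (B : set T) (x y : T -> V) w : B w -> splice B x y w = x w.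
Proof. by move=> Bw; rewrite /splice mem_set. Qed.

Lemma spliceF (T V : Type) (B : set T) (x y : T -> V) w : ~ B w -> splice B x y w = y w.
Proof. by move=> Bw; rewrite /splice memNset. Qed.

Section Emeas.
Variables (R : realType) (E : normedModType R) (d : measure_display)
  (Omega : measurableType d).
Implicit Types xi eta : Omega -> E.

Lemma Emeas_cst x : Emeas (fun _ : Omega => x : E).
Proof.
move=> U oU; have [Ux|Ux] := pselect (U x).
  by rewrite (_ : _ @^-1` _ = setT)//; apply/seteqP; split.
by rewrite (_ : _ @^-1` _ = set0)//; apply/seteqP; split.
Qed.

Lemma Emeas_splice (B : set Omega) xi eta : measurable B ->
  Emeas xi -> Emeas eta -> Emeas (splice B xi eta).
Proof.
move=> mB mx my U oU.
rewrite (_ : _ @^-1` _ = (B `&` xi @^-1` U) `|` (~` B `&` eta @^-1` U)).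
  apply: measurableU; apply: measurableI; [by []|exact: mx|exact: measurableC|exact: my].
apply/seteqP; split=> w /=.
  by have [Bw|Bw] := pselect (B w); [rewrite spliceT//; left|rewrite spliceF//; right].
by move=> [[Bw Uw]|[Bw Uw]]; [rewrite spliceT|rewrite spliceF].
Qed.

Lemma Emeas_continuous (f : E -> R) xi : continuous f -> Emeas xi ->
  measurable_fun setT (f \o xi).
Proof.
move=> /continuousP cf mx; apply: (measurability _ (RGenOInfty.measurableE R)) => //.
move=> _ [_ [r ->] <-]; rewrite setTI comp_preimage; apply/mx/cf.
exact: interval_open.
Qed.

Lemma Emeas_norm xi : Emeas xi -> measurable_fun setT (fun w => `|xi w|).
Proof. by apply: Emeas_continuous; exact: norm_continuous. Qed.

(** An open set is the union of the countably many balls of radius 1/(k+1) around some [D n] that it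
    contains. *)
Lemma Emeas_dense (D : nat -> E) xi :
  (forall x e, 0 < e -> exists n, `|x - D n| < e) ->
  (forall n (r : R), measurable [set w | `|xi w - D n| < r]) -> Emeas xi.
Proof.
move=> dD mx U oU.
rewrite (_ : _ @^-1` _ = [set w | exists n, exists k, 
    (forall x, `|x - D n| < k.+1%:R^-1 -> U x) /\ `|xi w - D n| < k.+1%:R^-1]).
  apply: measurable_exists => n; apply: measurable_exists => k.
  exact: (measurable_and_cst _ (mx n _)).
apply/seteqP; split=> w /=.
  move=> /(open_norm oU)[e e0 eU].
  have e20 : 0 < e / 2 by lra.
  have [k ke] := invS_lt e20.
  have [n xn] := dD (xi w) k.+1%:R^-1 ltac:(by rewrite invr_gt0).
  exists n, k; split => // x xD; apply: eU.
  have := ler_normD (xi w - D n) (D n - x); rewrite addrA subrK (distrC (D n)) => h.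
  move: xn xD ke h; set r := _^-1 => xn xD ke h; lra.
by move=> [n [k [kU xk]]]; exact: kU.
Qed.

Hypothesis sepE : separable E.

(** Separability makes pairs of balls around dense points a countable family that exhausts the open
    set of pairs [(x, y)] with [a *: x + y] in [U]. *)
Lemma Emeas_comb a xi eta : Emeas xi -> Emeas eta -> Emeas (a *: xi + eta).
Proof.
move: sepE => [D dD] mx my U oU.
have mball (z : Omega -> E) n (r : R) : Emeas z -> measurable [set w | `|z w - D n| < r].
  move=> mz; have := mz _ (ball_open (D n) r).
  by rewrite -ball_normE; congr measurable; apply/seteqP; split=> w /=; rewrite distrC.
rewrite (_ : _ @^-1` _ = [set w | exists n, exists m, exists k,
    (forall x y, `|x - D n| < k.+1%:R^-1 -> `|y - D m| < k.+1%:R^-1 -> U (a *: x + y)) /\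
    ([set w | `|xi w - D n| < k.+1%:R^-1] `&` [set w | `|eta w - D m| < k.+1%:R^-1]) w]).
  apply: measurable_exists => n; apply: measurable_exists => m.
  apply: measurable_exists => k; apply: (measurable_and_cst _ (measurableI _ _ _ _)).
    exact: mball.
  exact: mball.
apply/seteqP; split=> w /=; last first.
  by move=> [n [m [k [kU [xk yk]]]]]; exact: kU.
move=> /(open_norm oU)[e e0 eU].
have c0 : 0 < `|a| + 1 by rewrite ltr_wpDl.
(* Points in a common ball of radius [r] are less than [2 * r] apart, so the combination moves by at
   most 2r(|a| + 1), which is below [e]. *)
have e20 : 0 < e / (`|a| + 1) / 2 by rewrite !divr_gt0.
have [k ke] := invS_lt e20.
have [n xn] := dD (xi w) k.+1%:R^-1 ltac:(by rewrite invr_gt0).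
have [m ym] := dD (eta w) k.+1%:R^-1 ltac:(by rewrite invr_gt0).
exists n, m, k; split => // x y xD yD; apply: eU.
have := ler_normD (xi w - D n) (D n - x); rewrite addrA subrK (distrC (D n)) => h1.
have := ler_normD (eta w - D m) (D m - y); rewrite addrA subrK (distrC (D m)) => h2.
have -> : (a *: xi + eta) w - (a *: x + y) = a *: (xi w - x) + (eta w - y).
  by rewrite scalerBr opprD addrACA.
apply: le_lt_trans (ler_normD _ _) _; rewrite normrZ.
move: ke; rewrite !ltr_pdivlMr// => ke.
move: ke xn ym xD yD; set r := _^-1 => ke xn ym xD yD.
have h1' : `|xi w - x| < 2 * r by lra.
have h2' : `|eta w - y| < 2 * r by lra.
have := ler_wpM2l (normr_ge0 a) (ltW h1'); lra.
Qed.

Lemma EmeasD xi eta : Emeas xi -> Emeas eta -> Emeas (xi + eta).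
Proof. by move=> mx my; rewrite -[xi]scale1r; exact: Emeas_comb. Qed.

Lemma EmeasB xi eta : Emeas xi -> Emeas eta -> Emeas (fun w => xi w - eta w).
Proof.
move=> mx my.
rewrite (_ : (fun w => _) = -1 *: eta + xi); first exact: Emeas_comb.
by apply/funext => w; rewrite addrC scaleN1r.
Qed.

End Emeas.

(** * The space [L^p(E)] *)

Section Lp_space.
Variables (R : realType) (E : normedModType R) (d : measure_display)
  (Omega : measurableType d) (P : probability Omega R) (p : R).
Hypothesis sepE : separable E.
Hypothesis p1 : 1 <= p.
Implicit Types xi eta zeta : Omega -> E.

Local Notation Lp := (@Lp R E d Omega P p).
Local Notation Lpnormp := (Lpnormp P p).
Local Notation Lpd := (Lpd P p).

Let p_gt0 : 0 < p. Proof. exact: lt_le_trans ltr01 p1. Qed.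

Lemma measurable_pnorm xi : Emeas xi ->
  measurable_fun setT (fun w => (`|xi w| `^ p)%:E).
Proof.
move=> mx; apply/measurable_EFinP.
exact: (measurableT_comp (measurable_powR p) (Emeas_norm mx)).
Qed.

Lemma Lpnormp_ge0 xi : (0 <= Lpnormp xi)%E.
Proof. by apply: integral_ge0 => w _; rewrite lee_fin powR_ge0. Qed.

Lemma powR_le_norm (a b : R) : 0 <= a -> a <= b -> a `^ p <= b `^ p.
Proof.
move=> a0 ab; apply: ge0_ler_powR => //; first exact: ltW.
by rewrite nnegrE (le_trans a0).
Qed.

Lemma ae_le_Lpnormp xi eta : Emeas xi -> Emeas eta ->
  {ae P, forall w, `|xi w| <= `|eta w|} -> (Lpnormp xi <= Lpnormp eta)%E.
Proof.
move=> mx my xy.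
have nneg (th : Omega -> E) w : setT w -> (0 <= (`|th w| `^ p)%:E)%E.
  by rewrite lee_fin powR_ge0.
apply: (ae_ge0_le_integral measurableT (nneg xi) (measurable_pnorm mx)
  (nneg eta) (measurable_pnorm my)).
by apply: filterS xy => w xy _; rewrite lee_fin powR_le_norm.
Qed.

Lemma powR_add_le (a b : R) : 0 <= a -> 0 <= b ->
  (a + b) `^ p <= 2 `^ p * (a `^ p + b `^ p).
Proof.
move=> a0 b0.
wlog ab : a b a0 b0 / a <= b.
  move=> h; have [ab|ba] := leP a b; first exact: h.
  by rewrite addrC [X in _ * X]addrC; apply: h => //; exact: ltW.
apply: (@le_trans _ _ ((2 * b) `^ p)).
  by apply: powR_le_norm; lra.
by rewrite powRM// ler_wpM2l ?powR_ge0// lerDr powR_ge0.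
Qed.

(** The quasi-triangle inequality, with the factor 2^p from bounding a sum by twice its larger term.
    The hypothesis is pointwise so that sums, differences, gluings and convex combinations are all
    covered. *)
Lemma Lpnormp_add_le xi eta zeta : Emeas xi -> Emeas eta -> Emeas zeta ->
  (forall w, `|zeta w| <= `|xi w| + `|eta w|) ->
  (Lpnormp zeta <= (2 `^ p)%:E * (Lpnormp xi + Lpnormp eta))%E.
Proof.
move=> mx my mz h.
have mxy := emeasurable_funD (measurable_pnorm mx) (measurable_pnorm my).
have nneg (th : Omega -> E) w : setT w -> (0 <= (`|th w| `^ p)%:E)%E.
  by rewrite lee_fin powR_ge0.
have nnegD w : setT w -> (0 <= (`|xi w| `^ p)%:E + (`|eta w| `^ p)%:E)%E.
  by move=> _; rewrite -EFinD lee_fin addr_ge0 ?powR_ge0.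
rewrite -(ge0_integralD P measurableT (nneg xi) (measurable_pnorm mx)
  (nneg eta) (measurable_pnorm my)).
rewrite -(ge0_integralZl_EFin P measurableT nnegD mxy) ?powR_ge0//.
have m2 : measurable_fun setT
    (fun w => (2 `^ p)%:E * ((`|xi w| `^ p)%:E + (`|eta w| `^ p)%:E))%E.
  exact: measurable_funeM.
apply: (ge0_le_integral P measurableT (nneg zeta) (measurable_pnorm mz) m2).
move=> w _; rewrite -EFinD -EFinM lee_fin.
exact: le_trans (powR_le_norm _ (h w)) (powR_add_le _ _).
Qed.

Lemma LpnormpZ a xi : Emeas xi -> Lpnormp (a *: xi) = ((`|a| `^ p)%:E * Lpnormp xi)%E.
Proof.
move=> mx; have nneg w : setT w -> (0 <= (`|xi w| `^ p)%:E)%E by rewrite lee_fin powR_ge0.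
rewrite -(ge0_integralZl_EFin P measurableT nneg (measurable_pnorm mx)) ?powR_ge0//.
by apply: eq_integral => w _; rewrite -EFinM -powRM// -normrZ.
Qed.

Lemma Lp_cst x : Lp (fun _ => x).
Proof.
split; first exact: Emeas_cst.
suff -> : Lpnormp (fun _ => x) = (`|x| `^ p)%:E by rewrite ltry.
transitivity ((`|x| `^ p)%:E * P setT)%E; first exact: integral_cst.
by rewrite -[RHS]mule1; congr (_ * _)%E; exact: probability_setT.
Qed.

Lemma Lpd_ge0 xi eta : (0 <= Lpd xi eta)%E.
Proof. exact: Lpnormp_ge0. Qed.

Lemma LpdC xi eta : Lpd xi eta = Lpd eta xi.
Proof. rewrite /Defs.Lpd /Defs.Lpnormp; apply: eq_integral => w _.
by rewrite distrC. Qed.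

Lemma Lpdxx xi : Lpd xi xi = 0%E.
Proof.
rewrite /Defs.Lpd /Defs.Lpnormp; apply: integral0_eq => w _.
by rewrite /= subrr normr0 powR0 ?gt_eqF.
Qed.

Lemma Lpnormp_eq0 xi : Emeas xi -> Lpnormp xi = 0%E -> {ae P, forall w, xi w = 0}.
Proof.
move=> mx x0.
have := (ae_eq_integral_abs P measurableT (measurable_pnorm mx)).1.
have -> : (\int[P]_(w in setT) `|(`|xi w| `^ p)%:E|)%E = Lpnormp xi.
  by apply: eq_integral => w _; rewrite gee0_abs// lee_fin powR_ge0.
move=> /(_ x0); apply: filterS => w /(_ I) /= [] /powR_eq0_eq0/eqP.
by rewrite normr_eq0 => /eqP.
Qed.

Lemma integral_normE xi :
  (\int[P]_x `|(EFin \o (fun w => `|xi w|%R)) x| `^ p)%E = Lpnormp xi.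
Proof. by apply: eq_integral => w _ /=; rewrite normr_id. Qed.

Lemma Lp_intro xi : Emeas xi -> (Lpnormp xi < +oo)%E -> Lp xi.
Proof. by split. Qed.

Lemma Lp_Emeas xi : Lp xi -> Emeas xi.
Proof. by case. Qed.

Lemma Lp_lty xi : Lp xi -> (Lpnormp xi < +oo)%E.
Proof. by case. Qed.

Lemma LpnormpE xi : Lpnormp xi = (\int[P]_w (`|xi w| `^ p)%:E)%E.
Proof. by []. Qed.

Lemma LpdE xi eta : Lpd xi eta = (\int[P]_w (`|xi w - eta w| `^ p)%:E)%E.
Proof. by []. Qed.

#[local] Opaque Defs.Lp Defs.Lpnormp.

Lemma Lp_add_le xi eta zeta : Lp xi -> Lp eta -> Emeas zeta ->
  (forall w, `|zeta w| <= `|xi w| + `|eta w|) -> Lp zeta.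
Proof.
move=> lx ly mz h; apply: Lp_intro; first exact: mz.
apply: le_lt_trans (Lpnormp_add_le (Lp_Emeas lx) (Lp_Emeas ly) mz h) _.
rewrite lte_mul_pinfty ?lee_fin ?powR_ge0//.
by rewrite lte_add_pinfty; [|exact: Lp_lty..].
Qed.

Lemma EmeasZ a xi : Emeas xi -> Emeas (a *: xi).
Proof.
by move=> mx; rewrite -[_ *: _]addr0; apply: Emeas_comb => //; exact: Emeas_cst.
Qed.

Lemma LpZ a xi : Lp xi -> Lp (a *: xi).
Proof.
move=> lx; have mx := Lp_Emeas lx; apply: Lp_intro; first exact: EmeasZ.
rewrite LpnormpZ// lte_mul_pinfty ?lee_fin ?powR_ge0//; exact: Lp_lty.
Qed.

Lemma LpD xi eta : Lp xi -> Lp eta -> Lp (xi + eta).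
Proof.
move=> lx ly; apply: (Lp_add_le lx ly) => [|w]; last exact: ler_normD.
by apply: EmeasD => //; exact: Lp_Emeas.
Qed.

Lemma Lp_subspace : subspace Lp.
Proof.
split; first exact: (Lp_cst 0).
by move=> a x y lx ly; exact: (LpD (LpZ a lx) ly).
Qed.

Lemma LpB xi eta : Lp xi -> Lp eta -> Lp (fun w => xi w - eta w).
Proof. exact: (subspaceB Lp_subspace). Qed.

Lemma Lp_splice B xi eta : measurable B -> Lp xi -> Lp eta -> Lp (splice B xi eta).
Proof.
move=> mB lx ly; apply: (Lp_add_le lx ly) => [|w].
  by apply: Emeas_splice => //; exact: Lp_Emeas.
by rewrite /splice; case: ifP => _; rewrite ?lerDl ?lerDr.
Qed.

Lemma Lpd_lty xi eta : Lp xi -> Lp eta -> (Lpd xi eta < +oo)%E.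
Proof. by move=> lx ly; have [] := LpB lx ly. Qed.

Lemma Lpd_triangle eta xi zeta : Emeas xi -> Emeas eta -> Emeas zeta ->
  (Lpd xi zeta <= (2 `^ p)%:E * (Lpd xi eta + Lpd eta zeta))%E.
Proof.
move=> mx my mz; apply: Lpnormp_add_le; [exact: EmeasB..|] => w.
by rewrite -[X in `|X - _|](subrK (eta w) (xi w)) -addrA ler_normD.
Qed.

Lemma Lpd_eq0 xi eta : Emeas xi -> Emeas eta -> Lpd xi eta = 0%E ->
  {ae P, forall w, xi w = eta w}.
Proof.
move=> mx my /Lpnormp_eq0 h; have {h} := h (EmeasB sepE mx my).
by apply: filterS => w /eqP; rewrite subr_eq0 => /eqP.
Qed.

(** Separation needs exact homogeneity and an exact triangle inequality, which the p-th power
    [Lpnormp] does not provide. *)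
Definition Lpnorm xi : R := fine (Lpnormp xi) `^ p^-1.

Lemma LpnormZ a xi : Lp xi -> Lpnorm (a *: xi) = `|a| * Lpnorm xi.
Proof.
move=> lx; have mx := Lp_Emeas lx; rewrite /Lpnorm LpnormpZ// fineM//; last first.
  by rewrite ge0_fin_numE ?Lpnormp_ge0// Lp_lty.
rewrite powRM ?powR_ge0 ?fine_ge0 ?Lpnormp_ge0// -powRrM mulfV ?gt_eqF//.
by rewrite powRr1.
Qed.

(** The scalar Minkowski inequality is applied to the real functions |xi| and |eta|, whose sum
    dominates |xi + eta| pointwise. *)
Lemma LpnormD xi eta : Lp xi -> Lp eta -> Lpnorm (xi + eta) <= Lpnorm xi + Lpnorm eta.
Proof.
move=> lx ly; have lxy := LpD lx ly.
have NE zeta : Lp zeta ->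
    (Lpnorm zeta)%:E = ('N[P]_(p%:E) [EFin \o (fun w => `|zeta w|%R)])%E.
  move=> lz; rewrite unlock /Lnorm /Lpnorm.
  rewrite integral_normE.
  by rewrite -[in RHS](@fineK _ (Lpnormp zeta)) ?ge0_fin_numE ?Lpnormp_ge0// Lp_lty.
rewrite -lee_fin EFinD [leLHS](NE _ lxy).
rewrite [X in (_ <= X + _)%E](NE _ lx) [X in (_ <= _ + X)%E](NE _ ly).
have mx := Emeas_norm (Lp_Emeas lx); have my := Emeas_norm (Lp_Emeas ly).
have := minkowski_EFin P mx my p1; apply: le_trans.
have mxy : measurable_fun setT (fun w => `|xi w| + `|eta w|).
  exact: measurable_funD.
pose u := fun w => (`|(xi + eta) w| `^ p)%:E.
pose v := fun w => ((`|xi w| + `|eta w|) `^ p)%:E.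
have u0 w : setT w -> (0 <= u w)%E by rewrite lee_fin powR_ge0.
have mv : measurable_fun setT v.
  by apply/measurable_EFinP; exact: (measurableT_comp (measurable_powR p)).
have uv w : setT w -> (u w <= v w)%E.
  by move=> _; rewrite lee_fin powR_le_norm// ler_normD.
have int_uv := ge0_le_integral P measurableT u0 (measurable_pnorm (Lp_Emeas lxy)) mv uv.
rewrite unlock /Lnorm integral_normE.
have -> : (\int[P]_x `|(EFin \o ((fun w => `|xi w|) \+ (fun w => `|eta w|))%R) x| `^ p)%E
    = (\int[P]_x v x)%E.
  by apply: eq_integral => w _ /=; rewrite ger0_norm// addr_ge0.
apply: gt0_ler_poweR; last exact: int_uv.
- by rewrite invr_ge0 ltW.
- by rewrite in_itv/= leey Lpnormp_ge0.
- by rewrite in_itv/= leey integral_ge0// => w _; rewrite lee_fin powR_ge0.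
Qed.

Lemma Lpnorm_lt xi (e : R) : 0 < e -> Lp xi ->
  (Lpnorm xi < e) = (Lpnormp xi < (e `^ p)%:E)%E.
Proof.
move=> e0 lx.
have xf : Lpnormp xi \is a fin_num by rewrite ge0_fin_numE ?Lpnormp_ge0// Lp_lty.
rewrite -(fineK xf) lte_fin /Lpnorm.
have xp : 0 <= fine (Lpnormp xi) by rewrite fine_ge0 ?Lpnormp_ge0.
set a := fine _ in xp *; have pN0 : p != 0 by rewrite gt_eqF.
rewrite !ltNge; congr (~~ _); apply/idP/idP => h.
  have := powR_le_norm (ltW e0) h.
  by rewrite -powRrM mulVf// powRr1.
have ip0 : 0 <= p^-1 by rewrite invr_ge0 ltW.
have := ge0_ler_powR ip0 (powR_ge0 e p) xp h.
by rewrite -powRrM mulfV// powRr1// ltW.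
Qed.

End Lp_space.

(** * Convex, decomposable and closed hulls *)

(* Without this, failing unifications unfold [Lp] down to the integral and do
   not terminate in reasonable time. *)
#[local] Opaque Defs.Lp Defs.Lpnormp Defs.Lpd Lpnorm.

Section convex_hull.
Variables (R : realType) (T : lmodType R).
Implicit Types A M : set T.

Lemma sub_convS A : A `<=` convS A.
Proof.
move=> x Ax; exists 1%N, (fun _ => 1), (fun _ => x).
by split => //; rewrite big_ord1 ?scale1r.
Qed.

Lemma convS_convex A : convexS (convS A).
Proof.
move=> _ _ t [n [l [y [l0 l1 Ay ->]]]] [m [k [z [k0 k1 Az ->]]]] /andP[t0 t1].
exists (n + m)%N,
  (fun i => match fintype.split i with inl a => t * l a | inr b => (1 - t) * k b end),
  (fun i => match fintype.split i with inl a => y a | inr b => z b end).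
have eL i : fintype.split (lshift m i) = inl i := unsplitK (inl i).
have eR i : fintype.split (rshift n i) = inr i := unsplitK (inr i).
split.
- by move=> i; case: fintype.split => a; rewrite mulr_ge0// subr_ge0.
- rewrite big_split_ord /=.
  under eq_bigr do rewrite eL.
  under [X in _ + X]eq_bigr do rewrite eR.
  by rewrite -!mulr_sumr l1 k1 !mulr1 addrC subrK.
- by move=> i; case: fintype.split => a.
- rewrite big_split_ord /= !scaler_sumr; congr (_ + _).
  + by apply: eq_bigr => i _; rewrite eL scalerA.
  + by apply: eq_bigr => i _; rewrite eR scalerA.
Qed.

(** Induction on the number of terms: the head is split off and the rest is renormalized by its
    total weight [s]; if [s = 0], all remaining weights vanish. *)
Lemma convS_min A M : A `<=` M -> convexS M -> convS A `<=` M.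
Proof.
move=> AM cM _ [n [l [y [l0 l1 Ay ->]]]].
have {Ay AM} My i : M (y i) by exact/AM/Ay.
elim: n l y l0 l1 My => [l y _|n IH l y l0 l1 My].
  by rewrite big_ord0 => /esym/eqP; rewrite oner_eq0.
rewrite big_ord_recl; rewrite big_ord_recl in l1.
set s := \sum_(i < n) _ in l1.
have s0 : 0 <= s by apply: sumr_ge0.
have [s00|sN0] := eqVneq s 0.
  rewrite [X in _ + X]big1 ?addr0; last first.
    move=> i _; suff -> : l (lift ord0 i) = 0 by rewrite scale0r.
    apply/eqP; rewrite eq_le l0 andbT -s00 /s (bigD1 i)//= lerDl.
    by apply: sumr_ge0.
  by move: l1; rewrite s00 addr0 => ->; rewrite scale1r.
have l0E : s = 1 - l ord0 by rewrite -l1 addrAC subrr add0r.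
have -> : \sum_(i < n) l (lift ord0 i) *: y (lift ord0 i) =
    (1 - l ord0) *: \sum_(i < n) (l (lift ord0 i) / s) *: y (lift ord0 i).
  rewrite scaler_sumr; apply: eq_bigr => i _.
  by rewrite scalerA -l0E mulrC divfK.
apply: cM => //; last by rewrite l0 -subr_ge0 -l0E.
apply: IH => // [i|]; first by rewrite divr_ge0.
by rewrite -mulr_suml divff.
Qed.

Lemma convS_mono A M : A `<=` M -> convS A `<=` convS M.
Proof.
move=> AM; apply: convS_min; last exact: convS_convex.
exact: subset_trans AM (@sub_convS _).
Qed.

End convex_hull.

Section decomposable_hull.
Variables (R : realType) (E : normedModType R) (d : measure_display)
  (Omega : measurableType d).
Implicit Types A M : set (Omega -> E).

Definition decomposable M := forall B x y, measurable B -> M x -> M y ->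
  M (splice B x y).

Lemma sum_partition m (Bs : 'I_m -> set Omega) (xi : 'I_m -> Omega -> E) i w :
  (forall i j, i != j -> Bs i `&` Bs j = set0) -> Bs i w ->
  \sum_(j < m) (\1_(Bs j) w) *: xi j w = xi i w.
Proof.
move=> dB Bw; rewrite (bigD1 i)//= indicE mem_set// scale1r big1 ?addr0// => j ji.
rewrite indicE memNset ?scale0r// => Bj.
have : (Bs j `&` Bs i) w by [].
by rewrite dB.
Qed.

Lemma sub_dec A : A `<=` dec A.
Proof.
move=> x Ax; exists 1%N, (fun _ => setT), (fun _ => x); split => //.
- by move=> i j; rewrite !ord1 eqxx.
- by move=> w; exists ord0.
- by apply/funext => w; rewrite big_ord1 indicT scale1r.
Qed.

Lemma dec_decomposable A : decomposable (dec A).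
Proof.
move=> B _ _ mB [m [Bs [xi [mBs dBs cBs Axi ->]]]] [n [Cs [ta [mCs dCs cCs Ata ->]]]].
have eL i : fintype.split (lshift n i) = inl i := unsplitK (inl i).
have eR i : fintype.split (rshift m i) = inr i := unsplitK (inr i).
pose Ds k := match fintype.split k with
  inl i => B `&` Bs i | inr j => ~` B `&` Cs j end.
pose za k := match fintype.split k with inl i => xi i | inr j => ta j end.
have dDs : forall i j, i != j -> Ds i `&` Ds j = set0.
  move=> i j; apply: contraNeq => /set0P[w].
  rewrite -(splitK i) -(splitK j) /Ds !unsplitK.
  case: (fintype.split i) => a; case: (fintype.split j) => b /= [[Bw aw] [Bw' bw]] //.
    apply/eqP; congr (lshift _ _); apply/eqP; apply: contrapT => /negP /dBs h.
    by have : (Bs a `&` Bs b) w by []; rewrite h.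
  apply/eqP; congr (rshift _ _); apply/eqP; apply: contrapT => /negP /dCs h.
  by have : (Cs a `&` Cs b) w by []; rewrite h.
exists (m + n)%N, Ds, za; split => //.
- move=> k; rewrite /Ds; case: fintype.split => i; apply: measurableI => //.
  exact: measurableC.
- move=> w; have [Bw|Bw] := pselect (B w).
    by have [i iw] := cBs w; exists (lshift n i); rewrite /Ds eL.
  by have [i iw] := cCs w; exists (rshift m i); rewrite /Ds eR.
- by move=> k; rewrite /za; case: fintype.split.
- apply/funext => w; have [Bw|Bw] := pselect (B w).
    have [i iw] := cBs w; rewrite spliceT// (sum_partition _ dBs iw).
    by rewrite (sum_partition (i := lshift n i) _ dDs) ?/za ?/Ds ?eL.
  have [i iw] := cCs w; rewrite spliceF// (sum_partition _ dCs iw).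
  by rewrite (sum_partition (i := rshift m i) _ dDs) ?/za ?/Ds ?eR.
Qed.

Lemma dec_min A M : M !=set0 -> A `<=` M -> decomposable M -> dec A `<=` M.
Proof.
move=> [z Mz] AM dM _ [m [Bs [xi [mBs dBs cBs Axi ->]]]].
(* A finite decomposition is an iterated two-piece gluing. The base value [z] is overridden
   everywhere because the [Bs i] cover. *)
pose g := foldr (fun i h => splice (Bs i) (xi i) h) z.
have Mg s : M (g s).
  by elim: s => //= i s IH; apply: dM => //; exact/AM/Axi.
have -> : (fun w => \sum_(i < m) (\1_(Bs i) w) *: xi i w) = g (enum 'I_m).
  apply/funext => w; have [i iw] := cBs w; rewrite (sum_partition _ dBs iw).
  have : i \in enum 'I_m by rewrite mem_enum.
  elim: (enum 'I_m) => // j s IH; rewrite inE => /orP[/eqP <-/=|/IH h/=].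
    by rewrite spliceT.
  have [ij|ij] := eqVneq i j; first by rewrite -ij spliceT.
  rewrite spliceF; first exact: h.
  move=> jw.
  by have : (Bs i `&` Bs j) w by []; rewrite dBs.
exact: Mg.
Qed.

Lemma dec_mono A M : M !=set0 -> A `<=` M -> dec A `<=` dec M.
Proof.
move=> [z Mz] AM; apply: dec_min; [by exists z; exact: sub_dec| |exact: dec_decomposable].
exact: subset_trans AM (@sub_dec _).
Qed.

Lemma splice_comb B (t s : R) (x y u v : Omega -> E) :
  t *: splice B x y + s *: splice B u v = splice B (t *: x + s *: u) (t *: y + s *: v).
Proof.
apply/funext => w.
change (t *: splice B x y w + s *: splice B u v w =
  splice B (t *: x + s *: u) (t *: y + s *: v) w).
by rewrite /splice; case: ifP.
Qed.

Lemma splicexx B (x : Omega -> E) : splice B x x = x.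
Proof. by apply/funext => w; rewrite /splice; case: ifP. Qed.

(** One variable is treated at a time: with the other fixed, the functions whose combination lies in
    [dec A] form a decomposable set, since gluing commutes with linear combinations. Minimality of
    [dec] then applies twice. *)
Lemma convexS_dec A : convexS A -> convexS (dec A).
Proof.
move=> cA x y t dx dy t01.
have [[z Az]|A0] := pselect (A !=set0); last first.
  (* [dec] of the empty set has an element only when [Omega] is empty, and then all functions
     agree. *)
  have A0' : A = set0.
    by apply/seteqP; split => // z Az; exfalso; apply: A0; exists z.
  suff -> : t *: x + (1 - t) *: y = x by [].
  move: dx dy => [m [Bs [xi [_ _ cB Axi ->]]]] [n [Cs [ta [_ _ _ Ata ->]]]].
  apply/funext => w; have [i _] := cB w.
  by have := Axi i; rewrite A0'.
have inner a : A a -> forall b, dec A b -> dec A (t *: a + (1 - t) *: b).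
  move=> Aa; apply: dec_min.
  - by exists a; apply: sub_dec; exact: cA.
  - by move=> b Ab; apply: sub_dec; exact: cA.
  - move=> B b c mB db dc; rewrite -(splicexx B a) splice_comb.
    exact: dec_decomposable.
suff h : dec A `<=` [set a | dec A (t *: a + (1 - t) *: y)] by exact: h.
apply: dec_min.
- by exists z; exact: inner.
- by move=> a Aa; exact: inner.
- move=> B b c mB db dc /=; rewrite -(splicexx B y) splice_comb.
  exact: dec_decomposable.
Qed.

(** The same argument, one variable at a time, with the roles of convexity and decomposability
    exchanged. *)
Lemma convS_decomposable M : decomposable M -> decomposable (convS M).
Proof.
move=> dM B x y mB cx cy.
have inner b : M b -> convS M `<=` [set a | convS M (splice B a b)].
  move=> Mb; apply: convS_min => [a Ma|a1 a2 t h1 h2 t01]/=.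
    by apply: sub_convS; exact: dM.
  have -> : splice B (t *: a1 + (1 - t) *: a2) b =
      t *: splice B a1 b + (1 - t) *: splice B a2 b.
    by rewrite splice_comb -scalerDl [t + _]addrC subrK scale1r.
  exact: convS_convex.
suff h : convS M `<=` [set b | convS M (splice B x b)] by exact: h.
apply: convS_min => [b Mb|b1 b2 t h1 h2 t01]/=; first exact: inner.
have -> : splice B x (t *: b1 + (1 - t) *: b2) =
    t *: splice B x b1 + (1 - t) *: splice B x b2.
  by rewrite splice_comb -scalerDl [t + _]addrC subrK scale1r.
exact: convS_convex.
Qed.

(** Both sides are convex, decomposable and contain [A], so minimality gives both inclusions. *)
Lemma convS_dec A : A !=set0 -> convS (dec A) = dec (convS A).
Proof.
move=> [z Az]; apply/seteqP; split.
- apply: convS_min; last exact/convexS_dec/convS_convex.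
  by apply: dec_mono; [exists z; exact: sub_convS|exact: sub_convS].
- apply: dec_min; first by exists z; exact/sub_convS/sub_dec.
    by apply: convS_mono; exact: sub_dec.
  exact/convS_decomposable/dec_decomposable.
Qed.

End decomposable_hull.

Section Lp_closure.
Variables (R : realType) (E : normedModType R) (d : measure_display)
  (Omega : measurableType d) (P : probability Omega R) (p : R).
Hypothesis sepE : separable E.
Hypothesis p1 : 1 <= p.
Implicit Types (xi eta : Omega -> E) (A M : set (Omega -> E)).

Local Notation Lp := (@Lp R E d Omega P p).
Local Notation Lpd := (Lpd P p).
Local Notation clp := (clp P p).

(** The radius e / (2 * 2^p) absorbs the constant of the quasi-triangle inequality. *)
Lemma quasi_lt (a b : \bar R) (e : R) : (0 <= a)%E -> (0 <= b)%E ->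
  (a < (e / (2 * 2 `^ p))%:E)%E -> (b < (e / (2 * 2 `^ p))%:E)%E ->
  ((2 `^ p)%:E * (a + b) < e%:E)%E.
Proof.
have c0 : 0 < 2 `^ p by rewrite powR_gt0.
case: a => [a| |]; case: b => [b| |] // _ _; rewrite ?lte_fin => // ha hb.
have -> : e = 2 `^ p * (e / (2 * 2 `^ p) + e / (2 * 2 `^ p)).
  rewrite invfM mulrA; set c := 2 `^ p in c0 *.
  have -> : e / 2 / c + e / 2 / c = e / c by rewrite -mulrDl -splitr.
  by rewrite mulrC divfK// gt_eqF.
by rewrite ltr_pM2l// ltrD.
Qed.

Lemma quasi_eps (e : R) : 0 < e -> 0 < e / (2 * 2 `^ p).
Proof. by move=> e0; rewrite divr_gt0// mulr_gt0// powR_gt0. Qed.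

Lemma clp_Lp M : clp M `<=` Lp.
Proof. by move=> x []. Qed.

Lemma sub_clp M : M `<=` Lp -> M `<=` clp M.
Proof.
move=> ML x Mx; split; first exact: ML.
by move=> e e0; exists x => //; rewrite Lpdxx.
Qed.

Lemma clp_mono M A : M `<=` A -> clp M `<=` clp A.
Proof.
move=> MA x [lx hx]; split => [|e e0]; first exact: lx.
by have [y My yx] := hx e e0; exists y => //; exact: MA.
Qed.

Lemma clp_idem M : M `<=` Lp -> clp (clp M) = clp M.
Proof.
move=> ML; apply/seteqP; split; last exact/sub_clp/clp_Lp.
move=> x [lx hx]; split => [|e e0]; first exact: lx.
have [y [ly hy] yx] := hx _ (quasi_eps e0).
have [z Mz zy] := hy _ (quasi_eps e0).
exists z; first exact: Mz.
apply: le_lt_trans (Lpd_triangle P sepE p1 (Lp_Emeas (ML _ Mz)) (Lp_Emeas ly) (Lp_Emeas lx)) _.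
exact: quasi_lt (Lpd_ge0 _ _ _ _) (Lpd_ge0 _ _ _ _) zy yx.
Qed.

Lemma ae_eq_Lpdr xi eta zeta : Emeas xi -> Emeas eta -> Emeas zeta ->
  {ae P, forall w, xi w = eta w} -> Lpd zeta xi = Lpd zeta eta.
Proof.
move=> mx my mz xy; apply/eqP; rewrite eq_le; apply/andP; split;
  (apply: ae_le_Lpnormp => //; [exact: EmeasB..|]).
- by apply: filterS xy => w ->.
- by apply: filterS xy => w ->.
Qed.

Lemma clp_saturated M : M `<=` Lp -> saturated P p (clp M).
Proof.
move=> ML; split; first exact: clp_Lp.
move=> x y [lx hx] ly xy; split => [|e e0]; first exact: ly.
have [z Mz zx] := hx _ e0; exists z; first exact: Mz.
by rewrite -(ae_eq_Lpdr (Lp_Emeas lx) (Lp_Emeas ly) (Lp_Emeas (ML _ Mz)) xy).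
Qed.

(** Common source of the stability of closures under gluing and under convex combinations: both
    operations are pointwise 1-Lipschitz for the sum of the two norms. *)
Lemma clp_op2 M (phi : (Omega -> E) -> (Omega -> E) -> Omega -> E) :
  M `<=` Lp ->
  (forall x y, Lp x -> Lp y -> Lp (phi x y)) ->
  (forall x y x' y' w,
     `|phi x y w - phi x' y' w| <= `|x w - x' w| + `|y w - y' w|) ->
  (forall x y, M x -> M y -> M (phi x y)) ->
  forall x y, clp M x -> clp M y -> clp M (phi x y).
Proof.
move=> ML Lphi hphi Mphi x y [lx hx] [ly hy]; split=> [|e e0]; first exact: Lphi.
have [x' Mx xx] := hx _ (quasi_eps e0); have [y' My yy] := hy _ (quasi_eps e0).
exists (phi x' y'); first exact: Mphi.
have lx' := ML _ Mx; have ly' := ML _ My.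
have mx := EmeasB sepE (Lp_Emeas lx') (Lp_Emeas lx).
have my := EmeasB sepE (Lp_Emeas ly') (Lp_Emeas ly).
have mphi := EmeasB sepE (Lp_Emeas (Lphi _ _ lx' ly')) (Lp_Emeas (Lphi _ _ lx ly)).
apply: (le_lt_trans (Lpnormp_add_le P p1 mx my mphi (hphi x' y' x y))).
exact: quasi_lt (Lpd_ge0 _ _ _ _) (Lpd_ge0 _ _ _ _) xx yy.
Qed.

Lemma clp_decomposable M : M `<=` Lp -> decomposable M -> decomposable (clp M).
Proof.
move=> ML dM B x y mB; apply: (clp_op2 (phi := splice B) ML).
- by move=> u v lu lv; exact: (Lp_splice p1 mB lu lv).
- by move=> u v u' v' w; rewrite /splice; case: ifP => _; rewrite ?lerDl ?lerDr.
- by move=> u v Mu Mv; exact: (dM _ _ _ mB Mu Mv).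
Qed.

Lemma convexS_Lp : convexS Lp.
Proof.
move=> x y t lx ly _; exact: (LpD sepE p1 (LpZ sepE t lx) (LpZ sepE (1 - t) ly)).
Qed.

Lemma clp_convex M : M `<=` Lp -> convexS M -> convexS (clp M).
Proof.
move=> ML cM x y t cx cy /andP[t0 t1].
apply: (clp_op2 (phi := fun u v => t *: u + (1 - t) *: v) ML).
- move=> u v lu lv; apply: (convexS_Lp lu lv); exact/andP.
- move=> u v u' v' w.
  have -> : (t *: u + (1 - t) *: v) w - (t *: u' + (1 - t) *: v') w =
     t *: (u w - u' w) + (1 - t) *: (v w - v' w).
    by rewrite !scalerBr addrACA -opprD.
  apply: le_trans (ler_normD _ _) _; rewrite !normrZ !ger0_norm ?subr_ge0//.
  by apply: lerD; rewrite ler_piMl// lerBlDr lerDl.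
- by move=> u v Mu Mv; apply: (cM _ _ _ Mu Mv); exact/andP.
- exact: cx.
- exact: cy.
Qed.

Lemma dec_Lp A : A `<=` Lp -> dec A `<=` Lp.
Proof.
move=> AL; apply: dec_min AL _; first by exists (fun _ => 0); exact: Lp_cst.
by move=> B x y mB lx ly; exact: (Lp_splice p1 mB lx ly).
Qed.

Lemma convS_Lp A : A `<=` Lp -> convS A `<=` Lp.
Proof. by move=> AL; exact: (convS_min AL convexS_Lp). Qed.

End Lp_closure.

(** * Closed decomposable sets (Hiai-Umegaki) *)

Section measurable_lt.
Context d (Omega : measurableType d) (R : realType).
Implicit Types f g : Omega -> R.

Lemma measurable_lt_set f g : measurable_fun setT f -> measurable_fun setT g ->
  measurable [set w | f w < g w].
Proof.
move=> mf mg.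
have mfg : measurable_fun setT (fun w => f w < g w) by exact: measurable_fun_ltr.
have : measurable (setT `&` (fun w => f w < g w) @^-1` [set true]) by exact: mfg.
by rewrite setTI.
Qed.

Lemma measurable_le_set f g : measurable_fun setT f -> measurable_fun setT g ->
  measurable [set w | f w <= g w].
Proof.
move=> mf mg; rewrite (_ : [set _ | _] = ~` [set w | g w < f w]).
  by apply: measurableC; exact: measurable_lt_set.
by apply/seteqP; split=> w /=; rewrite leNgt => /negP.
Qed.

End measurable_lt.

Section Hiai_Umegaki.
Variables (R : realType) (E : normedModType R) (d : measure_display)
  (Omega : measurableType d) (P : probability Omega R) (p : R).
Hypothesis sepE : separable E.
Hypothesis p1 : 1 <= p.
Variable M : set (Omega -> E).
Local Notation Lp := (@Lp R E d Omega P p).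
Local Notation Lpd := (Lpd P p).
Local Notation clp := (clp P p).
Hypothesis ML : M `<=` Lp.
Hypothesis dM : decomposable M.

Let p_gt0 : 0 < p. Proof. exact: lt_le_trans ltr01 p1. Qed.

Let mdist x y : Lp x -> Lp y -> measurable_fun setT (fun w => `|x w - y w|).
Proof. by move=> lx ly; exact: Emeas_norm (EmeasB sepE (Lp_Emeas lx) (Lp_Emeas ly)). Qed.

Let mdistp x y : Lp x -> Lp y -> measurable_fun setT (fun w => (`|x w - y w| `^ p)%:E).
Proof.
by move=> lx ly; exact: (measurable_pnorm p (EmeasB sepE (Lp_Emeas lx) (Lp_Emeas ly))).
Qed.

(* [g n] realizes the pointwise minimum of the distances [|h k w - x w|], k <= n;
   dominated convergence by [|h 0 - x|^p] *)
Lemma clp_selection (h : nat -> Omega -> E) x : (forall n, M (h n)) -> Lp x ->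
  {ae P, forall w, closure (range (fun n => h n w)) (x w)} -> clp M x.
Proof.
move=> Mh lx hx.
pose g := fix g n : Omega -> E := if n is n'.+1 then
  splice [set w | `|h n'.+1 w - x w| < `|g n' w - x w|] (h n'.+1) (g n') else h 0%N.
have Mg n : M (g n).
  elim: n => [|n IH]; first exact: Mh.
  apply: (dM _ (Mh _) IH); apply: measurable_lt_set.
    exact: (mdist (ML (Mh _)) lx).
  exact: (mdist (ML IH) lx).
have gS n w : `|g n.+1 w - x w| <= `|h n.+1 w - x w| /\
              `|g n.+1 w - x w| <= `|g n w - x w|.
  rewrite /=; set S := [set w | _].
  have [Sw|Sw] := pselect (S w).
    by rewrite spliceT//; split => //; exact: ltW.
  by rewrite spliceF//; split => //; rewrite leNgt; exact/negP.
have gh n k w : (k <= n)%N -> `|g n w - x w| <= `|h k w - x w|.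
  elim: n => [|n IH]; first by rewrite leqn0 => /eqP ->.
  rewrite leq_eqVlt => /orP[/eqP ->|]; first exact: (gS n w).1.
  by rewrite ltnS => /IH; exact: le_trans (gS n w).2.
pose f_ n w := (`|g n w - x w| `^ p)%:E : \bar R.
pose f0 w := (`|h 0%N w - x w| `^ p)%:E : \bar R.
have [|||_ _] := @dominated_convergence _ _ _ P setT measurableT f_ (cst 0%E) f0
  (fun n => mdistp (ML (Mg n)) lx) (measurable_cst _).
- apply: filterS hx => w /closure_norm hw _.
  apply: cvg_EFin; first exact: nearW.
  apply/cvgrPdist_lt => e e0.
  have ep0 : 0 < e `^ p^-1 by rewrite powR_gt0.
  have [_ [k _ <-] xk] := hw _ ep0.
  near=> n; rewrite sub0r normrN ger0_norm ?powR_ge0//=.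
  apply: (@le_lt_trans _ _ (`|h k w - x w| `^ p)).
    by apply: (powR_le_norm p1) => //; apply: gh; near: n; exists k.
  have -> : e = (e `^ p^-1) `^ p.
    by rewrite -powRrM mulVf ?gt_eqF// powRr1// ltW.
  by apply: gt0_ltr_powR; rewrite ?nnegrE ?normr_ge0 ?powR_ge0// distrC.
- apply/integrableP; split; first exact: (mdistp (ML (Mh 0%N)) lx).
  have -> : (\int[P]_w `|f0 w| = Lpd (h 0%N) x)%E.
    by rewrite LpdE; apply: eq_integral => w _; rewrite gee0_abs// lee_fin powR_ge0.
  exact: (Lpd_lty sepE p1 (ML (Mh 0%N)) lx).
- apply: aeW => w n _; rewrite gee0_abs ?lee_fin ?powR_ge0//.
  by apply: (powR_le_norm p1) => //; exact: gh.
rewrite integral0 => cvg0.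
split => [|e e0]; first exact: lx.
have [n _ hn] : \forall n \near \oo, (Lpd (g n) x < e%:E)%E.
  have : nbhs (0 : \bar R) [set y : \bar R | (y < e%:E)%E].
    by apply: open_nbhs_nbhs; split; [exact: open_ereal_lt_ereal|rewrite /= lte_fin].
  by move=> /cvg0 [N _ hN]; exists N.
by exists (g n); [exact: Mg|exact: (hn n (leqnn n))].
Unshelve. all: by end_near. Qed.

(* [g] minimizes the L^p distance to the constant [c] over [M].  If some [x]
   in [M] were closer to [c] than all [g n] on a set [S] of positive
   probability, then splicing [x] into [g n] on [S] would beat the infimum. *)
Lemma minimizing_sequence (c : E) : M !=set0 ->
  exists2 g : nat -> Omega -> E, (forall n, M (g n)) &
    forall x (r s : R), M x -> 0 <= r -> r < s ->
      P [set w | `|x w - c| < r /\ forall n, s <= `|g n w - c|] = 0%E.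
Proof.
move=> [z Mz].
pose c' := fun _ : Omega => c.
have lc : Lp c' by exact: Lp_cst.
pose J y := fine (Lpd y c').
have Jfin y : M y -> (J y)%:E = Lpd y c'.
  move=> /ML ly; rewrite fineK// ge0_fin_numE ?Lpd_ge0//.
  exact: (Lpd_lty sepE p1 ly lc).
have hJ : has_inf [set J y | y in M].
  split; first by exists (J z), z.
  by exists 0 => _ [y My <-]; rewrite fine_ge0// Lpd_ge0.
have /choice[g hg] : forall n : nat, exists g, M g /\ J g < inf [set J y | y in M] + n.+1%:R^-1.
  move=> n; have n0 : 0 < n.+1%:R^-1 :> R by rewrite invr_gt0.
  by have [_ [y My <-] hy] := inf_adherent n0 hJ; exists y.
exists g => [n|x r s Mx r0 rs]; first by have [] := hg n.
have Mg n := (hg n).1.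
set S := [set w | _].
have mS : measurable S.
  apply: measurableI.
    by apply: measurable_lt_set => //; exact: (mdist (ML Mx) lc).
  apply: measurable_forall => n.
  by apply: measurable_le_set => //; exact: (mdist (ML (Mg n)) lc).
pose k := s `^ p - r `^ p.
have k0 : 0 < k.
  by rewrite subr_gt0; apply: gt0_ltr_powR => //; rewrite nnegrE ltW// (le_lt_trans r0).
(* Splicing lowers the integrand by at least [k] on [S], whereas [g n] is within 1/(n+1) of the
   infimum. *)
have key n : k * fine (P S) <= n.+1%:R^-1.
  have My : M (splice S x (g n)) by exact: dM.
  have PSf : (fine (P S))%:E = P S by rewrite fineK// fin_num_measure.
  suff : (J (splice S x (g n)) + k * fine (P S) <= J (g n)).
    have : inf [set J y | y in M] <= J (splice S x (g n)).
      by apply: ge_inf; [case: hJ|exists (splice S x (g n))].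
    have := (hg n).2; set u := n.+1%:R^-1; set v := inf _; set a := J (splice _ _ _).
    by set b := J (g n); set e := k * _; move: u v a b e => u v a b e; lra.
  rewrite -lee_fin EFinD EFinM PSf (Jfin _ My) (Jfin _ (Mg n)).
  have m1 := mdistp (ML My) lc.
  have mI : measurable_fun setT (fun w => (\1_S w)%:E : \bar R).
    by apply/measurable_EFinP; exact: measurable_indic.
  have I0 w : setT w -> (0 <= (\1_S w)%:E :> \bar R)%E by rewrite lee_fin indicE.
  have kI0 w : setT w -> (0 <= k%:E * (\1_S w)%:E :> \bar R)%E.
    by move=> _; rewrite mule_ge0 ?lee_fin ?(ltW k0)// indicE.
  have d0 (y : Omega -> E) w : setT w -> (0 <= (`|y w - c' w| `^ p)%:E)%E.
    by rewrite lee_fin powR_ge0.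
  have mkI : measurable_fun setT (fun w => k%:E * (\1_S w)%:E : \bar R)%E.
    exact: measurable_funeM.
  have -> : P S = (\int[P]_w (\1_S w)%:E)%E.
    by rewrite integral_indic// setIT.
  rewrite -(ge0_integralZl_EFin P measurableT I0 mI (ltW k0)) !LpdE.
  rewrite -(ge0_integralD P measurableT (d0 _) m1 kI0 mkI).
  apply: (ge0_le_integral P measurableT _ _ (mdistp (ML (Mg n)) lc)).
  - by move=> w Tw; exact: adde_ge0 (d0 _ _ Tw) (kI0 _ Tw).
  - exact: emeasurable_funD.
  move=> w _; rewrite -EFinM -EFinD lee_fin indicE.
  have [Sw|Sw] := pselect (S w); last by rewrite spliceF// memNset// mulr0 addr0.
  rewrite spliceT// mem_set// mulr1 /k.
  have := powR_le_norm p1 (normr_ge0 _) (ltW Sw.1).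
  have := powR_le_norm p1 (le_trans r0 (ltW rs)) (Sw.2 n).
  lra.
have PS0 : fine (P S) <= 0.
  rewrite leNgt; apply/negP => PS0.
  have [n] := invS_lt (mulr_gt0 k0 PS0).
  by rewrite ltNge key.
apply/eqP; rewrite eq_le measure_ge0 andbT -(fineK (fin_num_measure P S mS)).
by rewrite lee_fin.
Qed.

(** The sequence [h] collects minimizing sequences for all dense centers and is a Castaing
    representation of the multifunction. Where a member of [M] comes within 1/(k+1) of [D i], almost
    surely some [g i j] comes within 2/(k+1), so values of members lie in the closure; the converse
    is [clp_selection]. *)
Theorem decomposable_closed_LpX : M !=set0 -> clp M = M ->
  exists h : nat -> Omega -> E, (forall n, M (h n)) /\
    M = LpX P p (fun w => closure (range (fun n => h n w))).
Proof.
move=> M0 clM; have [D dD] := sepE.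
have /choice[g hg] := fun i => let: ex_intro2 g h1 h2 := minimizing_sequence (D i) M0 in
  ex_intro (fun g => _ /\ _) g (conj h1 h2).
pose h n := if unpickle n is Some (i, j) then g i j else g 0%N 0%N.
have Mh n : M (h n).
  by rewrite /h; case: unpickle => [[i j]|]; [exact: (hg i).1|exact: (hg 0%N).1].
exists h; split => //.
apply/seteqP; split=> x; last first.
  by move=> [lx hx]; rewrite -clM; exact: (clp_selection Mh lx hx).
move=> Mx; split; first exact: ML.
have ae1 : {ae P, forall w, forall i k : nat, ~ (`|x w - D i| < k.+1%:R^-1 /\
    forall j, 2 * k.+1%:R^-1 <= `|g i j w - D i|)}.
  apply: ae_foralln => i; apply: ae_foralln => k.
  have k0 : 0 < k.+1%:R^-1 :> R by rewrite invr_gt0.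
  have := (hg i).2 x k.+1%:R^-1 (2 * k.+1%:R^-1) Mx (ltW k0).
  move=> /(_ ltac:(by rewrite ltr_pMl// ltr1n)).
  set S := [set w | _] => PS.
  have mS : measurable S.
    have lD := Lp_cst P p (D i).
    apply: measurableI.
      by apply: measurable_lt_set => //; exact: (mdist (ML Mx) lD).
    apply: measurable_forall => n.
    by apply: measurable_le_set => //; exact: (mdist (ML ((hg i).1 n)) lD).
  exists S; split => // w /= /contrapT; exact.
apply: filterS ae1 => w hw; apply/closure_norm => e e0.
(* With [r] the radius 1/(k+1), the distances [r] from [x w] to [D i] and [2 * r] from [D i] to
   [g i j w] add up to [3 * r]. *)
have e30 : 0 < e / 3 by rewrite divr_gt0.
have [k ke] := invS_lt e30.
have [i xi] := dD (x w) k.+1%:R^-1 ltac:(by rewrite invr_gt0).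
have [j gj] : exists j, `|g i j w - D i| < 2 * k.+1%:R^-1.
  apply: contrapT => nj; apply: (hw i k); split => // j.
  by rewrite leNgt; apply/negP => gj; apply: nj; exists j.
exists (g i j w).
  by exists (pickle (i, j)) => //; rewrite /h pickleK.
have := ler_normD (x w - D i) (D i - g i j w); rewrite addrA subrK (distrC (D i)).
move: ke xi gj; set r := _^-1 => ke xi gj; lra.
Qed.

End Hiai_Umegaki.

(** * Measurable selections (Kuratowski-Ryll-Nardzewski) *)

(** Total, with value 0 when there is no witness; this default is the second alternative in
    [least_eq]. *)
Definition least (Q : nat -> Prop) : nat :=
  if pselect (exists n, `[< Q n >]) is left h then ex_minn h else 0%N.

Lemma leastP (Q : nat -> Prop) : (exists n, Q n) -> Q (least Q).
Proof.
move=> [n Qn]; rewrite /least; case: pselect => [h|[]]; last first.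
  by exists n; exact/asboolP.
by case: ex_minnP => m /asboolP.
Qed.

Lemma least_eq (Q : nat -> Prop) n : least Q = n <->
  (Q n /\ forall m, (m < n)%N -> ~ Q m) \/ (n = 0%N /\ forall m, ~ Q m).
Proof.
rewrite /least; case: pselect => [h|h].
  case: ex_minnP => m /asboolP Qm mmin; split.
    move=> <-; left; split => // k km /asboolP /mmin; by rewrite leqNgt km.
  move=> [[Qn nmin]|[_ /(_ m)]//].
  apply/eqP; rewrite eqn_leq mmin; last exact/asboolP.
  by rewrite leqNgt; apply/negP => /nmin.
split => [<-|[[Qn _]|[-> //]]].
  by right; split => // m Qm; apply: h; exists m; exact/asboolP.
by exfalso; apply: h; exists n; exact/asboolP.
Qed.

Lemma measurable_least d (Omega : measurableType d) (Q : Omega -> nat -> Prop) n :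
  (forall m, measurable [set w | Q w m]) -> measurable [set w | least (Q w) = n].
Proof.
move=> mQ; rewrite (_ : [set _ | _] =
  ([set w | Q w n] `&` [set w | forall m, ~ ((m < n)%N /\ Q w m)]) `|`
  [set w | n = 0%N /\ forall m, ~ Q w m]).
  apply: measurableU; first apply: measurableI => //.
    apply: measurable_forall => m; apply: measurableC.
    exact: (measurable_and_cst _ (mQ m)).
  apply: (@measurable_and_cst _ _ _ [set w | forall m, ~ Q w m]).
  by apply: measurable_forall => m; exact: (measurableC (mQ m)).
apply/seteqP; split=> w /=.
  by move=> /least_eq[[Qn nm]|[n0 nQ]]; [left; split=> // m [] /nm|right].
move=> h; apply/least_eq; case: h => [[Qn nm]|[n0 nQ]]; [left|right] => //.
by split => // m mn Qm; exact: (nm m).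
Qed.

Section selection.
Variables (R : realType) (E : completeNormedModType R) (d : measure_display)
  (Omega : measurableType d).

(** Approximation starts at [D n0] with steps shorter than r, r/2, r/4, and so on; their total 2r is
    the final bound. Values of [F] may be empty, so the claim is restricted to points where [F w]
    meets the initial ball; elsewhere the function is set to 0. *)
Theorem measurable_selection (D : nat -> E) (F : Omega -> set E) (n0 : nat) (r : R) :
  (forall x e, 0 < e -> exists n, `|x - D n| < e) ->
  closed_valued F -> effros F -> 0 < r ->
  exists2 x : Omega -> E, Emeas x & forall w,
    (exists2 z, F w z & `|D n0 - z| < r) -> F w (x w) /\ `|x w - D n0| <= 2 * r.
Proof.
move=> dD cF eF r0.
pose rho k : R := r / 2 ^+ k.
have rho0 k : 0 < rho k by rewrite divr_gt0// exprn_gt0.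
have rhoS k : rho k.+1 = rho k / 2 by rewrite /rho exprSr invfM mulrA.
have rho_small e : 0 < e -> exists k, 2 * rho k < e.
  move=> e0.
  have [k ke] := invS_lt (divr_gt0 (divr_gt0 e0 (ltr0Sn _ _)) r0 : 0 < e / 2 / r).
  exists k; rewrite mulrC -ltr_pdivlMr//; apply: le_lt_trans (_ : r / k.+1%:R < _).
    rewrite ler_pM2l// lef_pV2 ?posrE ?exprn_gt0//.
    by rewrite -natrX ler_nat ltn_expl.
  by rewrite mulrC -ltr_pdivlMr.
pose near_F n (e : R) w := exists2 z, F w z & `|D n - z| < e.
have m_near n e : measurable [set w | near_F n e w].
  have := eF _ (ball_open (D n) e); rewrite -ball_normE; congr measurable.
  by apply/seteqP; split=> w /= [z]; [move=> [Fz zD]; exists z|move=> Fz zD; exists z].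
(* [idx k w] indexes the [k]-th approximation [X k w], within [rho k] of [F w];
   the next index is the least one within [rho k] of it and within
   [rho k.+1] of [F w]. *)
pose Q k l w m := `|D l - D m| < rho k /\ near_F m (rho k.+1) w.
pose idx := fix idx k w := if k is k'.+1 then least (Q k' (idx k' w) w) else n0.
have m_idx k n : measurable [set w | idx k w = n].
  elim: k n => [|k IH] n.
    have [->|nn0] := eqVneq n n0.
      by rewrite (_ : [set _ | _] = setT)//; apply/seteqP; split.
    rewrite (_ : [set _ | _] = set0)//; apply/seteqP; split => // w /= h.
    by rewrite h eqxx in nn0.
  rewrite (_ : [set _ | _] = [set w | exists l,
    ([set w | idx k w = l] `&` [set w | least (Q k l w) = n]) w]).
    apply: measurable_exists => l; apply: measurableI => //.
    apply: measurable_least => m.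
    exact: (measurable_and_cst _ (m_near m _)).
  by apply/seteqP; split=> w /=; [move=> h; exists (idx k w)|move=> [l [<-]]].
pose T := [set w | near_F n0 r w].
pose X k w := D (idx k w).
have XF k w : T w -> near_F (idx k w) (rho k) w /\ `|X k w - X k.+1 w| < rho k.
  move=> Tw.
  have QX j : near_F (idx j w) (rho j) w -> Q j (idx j w) w (idx j.+1 w).
    move=> [z Fz zX]; apply: leastP.
    (* A dense point this close to [z] satisfies both demands: it lies within [rho j] of the current
       point and within [rho j.+1] of [F w]. *)
    pose e := Num.min (rho j - `|D (idx j w) - z|) (rho j / 2).
    have e0 : 0 < e by rewrite lt_min subr_gt0 zX divr_gt0.
    have [m zm] := dD z e e0; exists m.
    move: zm; rewrite lt_min => /andP[zm1 zm2]; split.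
      have := ler_normD (D (idx j w) - z) (z - D m); rewrite addrA subrK; lra.
    by exists z => //; rewrite rhoS distrC.
  have h j : near_F (idx j w) (rho j) w.
    elim: j => [|j /QX[]//]; by rewrite /= /rho expr0 divr1.
  by split; [|have [] := QX k (h k)].
(* The right-hand side is the geometric sum of the steps [rho k] up to [rho (k + j - 1)]. *)
have Xdist k j w : T w -> `|X k w - X (k + j)%N w| <= 2 * rho k - 2 * rho (k + j)%N.
  move=> Tw; elim: j => [|j IH]; first by rewrite addn0 !subrr normr0.
  have := ler_normD (X k w - X (k + j)%N w) (X (k + j)%N w - X (k + j).+1 w).
  rewrite addrA subrK addnS => h.
  have h2 := (XF (k + j)%N w Tw).2; have := rhoS (k + j)%N; lra.
have XT k n w : T w -> (k <= n)%N -> `|X k w - X n w| <= 2 * rho k.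
  move=> Tw kn; have := Xdist k (n - k)%N w Tw; rewrite subnKC// => h.
  have := rho0 n; lra.
have Xlim w : exists x, T w -> forall k, `|X k w - x| <= 2 * rho k.
  have [Tw|Tw] := pselect (T w); last by exists 0.
  have /cauchy_cvg Xcvg : cauchy (X^~ w @ \oo).
    apply: cauchy_exP => e e0; have [k ke] := rho_small e e0.
    exists (X k w); exists k => // n /= kn; rewrite -ball_normE /=.
    exact: le_lt_trans (XT k n w Tw kn) ke.
  exists (lim (X^~ w @ \oo)) => _ k; apply/ler_addgt0Pr => e e0.
  have /cvgrPdist_lt/(_ e e0)[N _ hN] := Xcvg.
  have := hN (maxn N k) (leq_maxl _ _) => /= h1.
  have h2 := XT k (maxn N k) w Tw (leq_maxr _ _).
  have := ler_normD (X k w - X (maxn N k) w) (X (maxn N k) w - lim (X^~ w @ \oo)).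
  rewrite addrA subrK (distrC (X (maxn N k) w)); lra.
have [x0 hx0] := choice Xlim.
exists (fun w => if w \in T then x0 w else 0).
  apply: (Emeas_dense dD) => n e.
  (* The limit is within [2 * rho k] of its [k]-th approximation, so being closer than [e] to [D n]
     is witnessed by one approximation with that margin to spare; these take countably many
     values. *)
  rewrite (_ : [set _ | _] = (T `&` [set w | exists k, exists l,
      `|D l - D n| < e - 2 * rho k /\ [set w | idx k w = l] w]) `|`
      (~` T `&` [set w | `|0 - D n| < e /\ setT w])).
    apply: measurableU; apply: measurableI.
    - exact: m_near.
    - apply: measurable_exists => k; apply: measurable_exists => l.
      exact: (measurable_and_cst _ (m_idx k l)).
    - by apply: measurableC; exact: m_near.
    - exact: (measurable_and_cst _ measurableT).
  apply/seteqP; split=> w /=.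
    have [Tw|Tw] := pselect (T w); last by rewrite memNset//; right.
    rewrite mem_set// => xe; left; split => //.
    have [k ke] : exists k, 2 * rho k < (e - `|x0 w - D n|) / 2.
      by apply: rho_small; rewrite divr_gt0// subr_gt0.
    exists k, (idx k w); split => //.
    have := hx0 w Tw k; have := ler_normD (X k w - x0 w) (x0 w - D n).
    rewrite addrA subrK /X; lra.
  move=> [[Tw [k [l [kl kE]]]]|[Tw [h _]]]; last by rewrite memNset.
  rewrite /= in kE; rewrite -kE in kl; rewrite mem_set//.
  have := hx0 w Tw k; have := ler_normD (x0 w - X k w) (X k w - D n).
  rewrite addrA subrK (distrC (x0 w) (X k w)) /X; lra.
move=> w Tw; rewrite mem_set//; split; last first.
  have := hx0 w Tw 0%N; rewrite /X /= /rho expr0 divr1 distrC.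
  by [].
rewrite ((closure_id (F w)).1 (cF w)); apply/closure_norm => e e0.
have [k ke] := rho_small (e / 2) (divr_gt0 e0 (ltr0Sn _ _)).
have [z Fz zX] := (XF k w Tw).1.
exists z => //; have := hx0 w Tw k; have := rho0 k.
have := ler_normD (x0 w - X k w) (X k w - z).
rewrite addrA subrK (distrC (x0 w) (X k w)); move: zX; rewrite -/(X k w); lra.
Qed.

Variables (P : probability Omega R) (p : R).
Hypothesis sepE : separable E.
Hypothesis p1 : 1 <= p.
Local Notation Lp := (@Lp R E d Omega P p).

Lemma Lp_bounded (x : Omega -> E) (C : R) : Emeas x -> (forall w, `|x w| <= C) -> Lp x.
Proof.
move=> mx xC; have [C0|C0] := leP 0 C; last first.
  have : forall w : Omega, False.
    by move=> w; have := le_trans (normr_ge0 _) (xC w); rewrite leNgt C0.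
  move=> noO; suff -> : x = (fun _ => 0) by exact: Lp_cst.
  by apply/funext => w; have := noO w.
apply: Lp_intro; first exact: mx.
rewrite LpnormpE.
apply: (@le_lt_trans _ _ (\int[P]_w (C `^ p)%:E)%E).
  apply: (ge0_le_integral P measurableT).
  - by move=> w _; rewrite lee_fin powR_ge0.
  - exact: measurable_pnorm.
  - exact: measurable_cst.
  - by move=> w _; rewrite lee_fin powR_le_norm.
have -> : (\int[P]_w (C `^ p)%:E)%E = ((C `^ p)%:E * P setT)%E.
  exact: integral_cst.
by rewrite lte_mul_pinfty ?lee_fin ?powR_ge0// -ge0_fin_numE ?fin_num_measure.
Qed.

(** If the inclusion failed on a set [S] of positive probability, a selection of [F] there within
    2/(k+1) of [D n] would, as part of a member of [LpX P p F], come within 1/(k+1) of some [h j].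
    That puts [h j] within 3/(k+1) of [D n], against the required 4/(k+1). *)
Lemma effros_sub_closure (F : Omega -> set E) (h : nat -> Omega -> E) :
  closed_valued F -> effros F -> (forall n, Lp (h n)) -> LpX P p F !=set0 ->
  LpX P p F `<=` LpX P p (fun w => closure (range (fun n => h n w))) ->
  {ae P, forall w, F w `<=` closure (range (fun n => h n w))}.
Proof.
move=> cF eF Lh [g0 [lg0 g0F]] FG; have [D dD] := sepE.
suff : {ae P, forall w, forall n k : nat, ~ ((exists2 z, F w z & `|D n - z| < k.+1%:R^-1) /\
    forall j, 4 * k.+1%:R^-1 <= `|h j w - D n|)}.
  apply: filterS => w hw z Fz; apply/closure_norm => e e0.
  have [k ke] := invS_lt (divr_gt0 e0 (ltr0Sn _ _) : 0 < e / 5).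
  have [n zn] := dD z k.+1%:R^-1 ltac:(by rewrite invr_gt0).
  have [j hj] : exists j, `|h j w - D n| < 4 * k.+1%:R^-1.
    apply: contrapT => nj; apply: (hw n k); split; first by exists z => //; rewrite distrC.
    by move=> j; rewrite leNgt; apply/negP => hj; apply: nj; exists j.
  exists (h j w); first by exists j.
  have := ler_normD (z - D n) (D n - h j w); rewrite addrA subrK (distrC (D n)).
  move: ke zn hj; set u := _^-1 => ke zn hj; lra.
apply: ae_foralln => n; apply: ae_foralln => k.
set S := [set w | (exists2 z, F w z & `|D n - z| < k.+1%:R^-1) /\
    forall j, 4 * k.+1%:R^-1 <= `|h j w - D n|].
have k0 : 0 < k.+1%:R^-1 :> R by rewrite invr_gt0.
have mS : measurable S.
  apply: measurableI.
    have := eF _ (ball_open (D n) k.+1%:R^-1); rewrite -ball_normE; congr measurable.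
    by apply/seteqP; split=> w /= [z]; [move=> [Fz zD]; exists z|move=> Fz zD; exists z].
  apply: measurable_forall => j; apply: measurable_le_set => //.
  exact: (Emeas_norm (EmeasB sepE (Lp_Emeas (Lh j)) (@Emeas_cst _ _ _ Omega (D n)))).
have [x mx hx] := measurable_selection n dD cF eF k0.
(* Cutting off by 0 gives a bounded function, hence one in [Lp]; [g0] is spliced in afterwards to
   obtain values in [F] off [S]. *)
have lx : Lp (splice S x (fun _ => 0)).
  apply: (@Lp_bounded _ (`|D n| + 2 * k.+1%:R^-1)).
    by apply: Emeas_splice => //; exact: Emeas_cst.
  move=> w; have [Sw|Sw] := pselect (S w); last first.
    by rewrite spliceF// normr0 addr_ge0// mulr_ge0// ltW.
  rewrite spliceT//; have := (hx w Sw.1).2.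
  have := ler_normD (x w - D n) (D n); rewrite subrK.
  set u := _^-1; lra.
have ly := Lp_splice p1 mS lx lg0.
have : LpX P p F (splice S (splice S x (fun _ => 0)) g0).
  split; first exact: ly.
  apply: filterS g0F => w g0w; have [Sw|Sw] := pselect (S w); last by rewrite spliceF.
  by rewrite !spliceT//; exact: (hx w Sw.1).1.
move=> /FG[_]; apply: filterS => w hw Sw.
move: hw; rewrite !spliceT// => /closure_norm/(_ _ k0)[_ [j _ <-] xj].
have := (hx w Sw.1).2; have := Sw.2 j.
have := ler_normD (h j w - x w) (x w - D n); rewrite addrA subrK (distrC (h j w) (x w)).
move: xj k0; set u := _^-1 => xj k0; lra.
Qed.

End selection.

(** * Choquet decomposable hulls *)

Section borel.
Variables (R : realType) (E : normedModType R).

Lemma open_EB (U : set E) : open U -> measurable (U : set (EB E)).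
Proof. exact: sub_sigma_algebra. Qed.

Lemma closed_EB (U : set E) : closed U -> measurable (U : set (EB E)).
Proof.
move=> cU; rewrite -[U]setCK; apply: (@measurableC _ (EB E)).
by apply: open_EB; exact: closed_openC.
Qed.

Lemma continuous_EB (L : E -> R) : continuous L ->
  measurable_fun setT (L : EB E -> R).
Proof.
move=> /continuousP cL; apply: (measurability _ (RGenOInfty.measurableE R)) => //.
move=> _ [_ [r ->] <-]; rewrite setTI; apply: open_EB; apply: cL.
exact: interval_open.
Qed.

Lemma radonE_dirac (a : E) : radonE (@dirac _ (EB E) a R : probability (EB E) R).
Proof.
move=> B mB; apply/eqP; rewrite eq_le; apply/andP; split; last first.
  apply: ge_ereal_sup => _ [K [_ KB] <-]; rewrite /dirac lee_fin !indicE.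
  have [Ka|Ka] := pselect (K a); last by rewrite memNset.
  by rewrite !mem_set//; exact: KB.
rewrite [leLHS]diracE; have [Ba|Ba] := pselect (B a).
  apply: ereal_sup_ubound; exists [set a].
    by split; [exact: compact_set1|move=> _ ->].
  by rewrite !mem_set//= diracE mem_set.
rewrite memNset//; apply: ereal_sup_ubound; exists set0; last exact: dirac0.
by split; [exact: compact0|].
Qed.

Lemma integrable_dirac (a : E) (L : E -> R) : continuous L ->
  (@dirac _ (EB E) a R).-integrable setT (fun x : EB E => (L x)%:E) /\
  (\int[@dirac _ (EB E) a R]_x (L x)%:E)%E = (L a)%:E.
Proof.
move=> cL; have mL : measurable_fun setT (fun x : EB E => (L x)%:E).
  by apply/measurable_EFinP; exact: continuous_EB.
have iE (f : EB E -> \bar R) : measurable_fun setT f ->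
    (\int[@dirac _ (EB E) a R]_x f x)%E = f a.
  by move=> mf; rewrite integral_dirac// diracT mul1e.
split; last by rewrite iE.
apply/integrableP; split => //; rewrite iE ?ltry//.
exact: measurableT_comp.
Qed.

End borel.

Section Choquet_decomposable_hull.
Variables (R : realType) (E : completeNormedModType R) (d : measure_display)
  (Omega : measurableType d) (P : probability Omega R) (p : R).
Hypothesis sepE : separable E.
Hypothesis p1 : 1 <= p.
Implicit Types (A B : set (Omega -> E)) (F : Omega -> set E).
Local Notation Lp := (@Lp R E d Omega P p).
Local Notation clp := (clp P p).

Lemma Emeas_EB (x : Omega -> E) (B : set (EB E)) : Emeas x -> measurable B ->
  measurable (x @^-1` B).
Proof.
move=> mx mB.
suff : <<s @open E >> `<=` [set B | measurable (x @^-1` B)] by exact.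
apply: smallest_sub; last by move=> U oU; exact: mx.
split.
- by rewrite /= preimage_set0.
- by move=> U mU; rewrite /= setTD preimage_setC; exact: measurableC.
- by move=> G mG; rewrite /= preimage_bigcup; exact: bigcupT_measurable.
Qed.

(** An open set meets the closure exactly when it contains a term of the sequence. *)
Lemma effros_closure_range (h : nat -> Omega -> E) : (forall n, Emeas (h n)) ->
  effros (fun w => closure (range (fun n => h n w))).
Proof.
move=> mh U oU; rewrite (_ : [set _ | _] = [set w | exists n, (h n @^-1` U) w]).
  by apply: measurable_exists => n; exact: mh.
apply/seteqP; split=> w /=.
  move=> [z [cz Uz]]; have /cz[_ [[n _ <-] Uh]] : nbhs z U by exact: open_nbhs_nbhs.
  by exists n.
by move=> [n Uh]; exists (h n w); split => //; apply: subset_closure; exists n.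
Qed.

Lemma isFA_exists A : A !=set0 -> A `<=` Lp -> exists F, isFA P p A F.
Proof.
move=> [z Az] AL; have dL := dec_Lp p1 AL.
have cL : clp (dec A) `<=` Lp by exact: clp_Lp.
have [|h [Mh hM]] := decomposable_closed_LpX sepE p1 cL
  (clp_decomposable sepE p1 dL (@dec_decomposable _ _ _ _ A)) _ (clp_idem sepE p1 dL).
  by exists z; apply: (sub_clp p1 dL); exact: sub_dec.
exists (fun w => closure (range (fun n => h n w))); split; last exact: hM.
  by move=> w; exact: closed_closure.
by apply: effros_closure_range => n; exact: (Lp_Emeas (cL _ (Mh n))).
Qed.

(** Every [x] in [L^p(F_B)] is the barycenter of the Dirac kernel at [x], which is admissible for
    [B]; and [L^p(F_B)] is the closure of [dec B]. *)
Lemma chd_min A B : A `<=` Lp -> A !=set0 -> saturated P p B -> A `<=` B ->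
  pChoquetDec P p B -> clp (dec A) `<=` B.
Proof.
move=> AL [z Az] [BL satB] AB cB.
have B0 : B !=set0 by exists z; exact: AB.
have [G isG] := isFA_exists B0 BL; have [cG eG BG] := isG.
move=> x cx.
have [lx xG] : LpX P p G x.
  by rewrite -BG; apply: clp_mono cx; exact: dec_mono.
have mx := Lp_Emeas lx.
pose K w : probability (EB E) R := @dirac _ (EB E) (x w) R.
have Kbary : kbary P K x.
  by move=> L [_ cL]; apply: aeW => w; have [h1 h2] := integrable_dirac (x w) cL.
apply: (cB K) => //; split => //.
- split=> [C mC|w]; last exact: radonE_dirac.
  rewrite (_ : (fun w => _) = EFin \o \1_(x @^-1` C)).
    by apply/measurable_EFinP; apply: measurable_indic; exact: Emeas_EB.
  by apply/funext => w; rewrite /K /= /dirac !indicE.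
- exists G; split => //; apply: filterS xG => w Gx.
  by rewrite /K /= diracE mem_set.
- by exists x.
- by apply: aeW => w; exists (x w) => C mC; rewrite /K /= /dirac.
Qed.

(** The exceptional null set in [kbary] depends on the functional, so only countably many may be
    tested at once; a separating sequence identifies [Y w] with the atom of [K w]. *)
Lemma kbary_dirac_LpX (K : Omega -> probability (EB E) R) F Y : closed_valued F ->
  Lp Y -> {ae P, forall w, K w (F w : set (EB E)) = 1%E} ->
  {ae P, forall w, isdirac (K w)} -> kbary P K Y -> LpX P p F Y.
Proof.
move=> cF lY KF Kd KY; split; first exact: lY.
have [L [dL sepL]] := dual_separating sepE.
have : {ae P, forall w, forall n, (L n (Y w))%:E = (\int[K w]_x (L n x)%:E)%E}.
  by apply: ae_foralln => n; apply: filterS (KY _ (dL n)) => w [].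
apply: filterS3 KF Kd => w KF [a Ka] hL.
have Fa : F w a.
  have := Ka _ (closed_EB (cF w)); rewrite KF indicE.
  have [//|Fa] := pselect (F w a).
  by rewrite memNset// => /eqP; rewrite eqe oner_eq0.
suff -> : Y w = a by [].
apply/eqP; rewrite -subr_eq0; apply/eqP; apply: sepL => n.
have [Llin Lc] := dL n.
have LY : L n (Y w) = L n a.
  apply: EFin_inj; rewrite hL -(integrable_dirac a Lc).2.
  by apply: eq_measure_integral => C mC _; exact: (Ka C mC).
have := Llin (-1) a (Y w); rewrite scaleN1r addrC => ->.
by rewrite LY mulN1r addNr.
Qed.

Lemma clp_dec_pChoquetDec A : A `<=` Lp -> pChoquetDec P p (clp (dec A)).
Proof.
move=> AL K [_ [F [[cF _ FE] KF]] _ Kd] Y lY KY.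
have dL := dec_Lp p1 AL.
have cD := clp_decomposable sepE p1 dL (@dec_decomposable _ _ _ _ A).
have : LpX P p F Y by exact: kbary_dirac_LpX KY.
rewrite -FE => h; rewrite -(clp_idem sepE p1 dL).
(* An empty hull has an empty [dec], because a probability space is nonempty. *)
have [[z cz]|c0] := pselect (clp (dec A) !=set0).
  apply: clp_mono h; apply: dec_min => //; by exists z.
apply: clp_mono h => x [m [Bs [xi [_ _ cB cxi _]]]].
exfalso; apply: c0.
have [w _] : [set: Omega] !=set0.
  apply/set0P; apply/negP => /eqP T0; have := @probability_setT _ _ _ P.
  by rewrite T0 measure0 => /eqP; rewrite eqe eq_sym oner_eq0.
by have [i _] := cB w; exists (xi i).
Qed.

Lemma chdE A : A `<=` Lp -> A !=set0 -> chd P p A = clp (dec A).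
Proof.
move=> AL A0; have dL := dec_Lp p1 AL; apply/seteqP; split=> x.
  apply; first exact: (clp_saturated sepE p1 dL).
  - by move=> y Ay; apply: (sub_clp p1 dL); exact: sub_dec.
  - exact: clp_dec_pChoquetDec.
by move=> cx B sB AB cB; exact: (chd_min AL A0 sB AB cB).
Qed.

End Choquet_decomposable_hull.

(** * Choquet sets in [L^p(E)] *)

Section Choquet_sets.
Variables (R : realType) (E : normedModType R) (d : measure_display)
  (Omega : measurableType d) (P : probability Omega R) (p : R).
Hypothesis sepE : separable E.
Hypothesis p1 : 1 <= p.
Implicit Types (A B : set (Omega -> E)).
Local Notation Lp := (@Lp R E d Omega P p).
Local Notation Lpd := (Lpd P p).
Local Notation clp := (clp P p).
Local Notation VB := (VB E P p).
Local Notation Vopen := (@Vopen R E d Omega P p).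

Let p_gt0 : 0 < p. Proof. exact: lt_le_trans ltr01 p1. Qed.

Lemma measurable_Vopen (O : set VB) : Vopen O -> measurable O.
Proof. exact: sub_sigma_algebra. Qed.

Lemma Vopen_Lp : Vopen Lp.
Proof. by split => // x lx; exists 1; split => // y ly _. Qed.

Lemma measurable_Lp : measurable (Lp : set VB).
Proof. exact: (measurable_Vopen Vopen_Lp). Qed.

(** A barycenter [y] at positive distance from [B] would be separated by some [f] lying below [f y]
    by a fixed margin on [B]. Since [mu] is carried by [C], integrating [f] over [C] contradicts the
    barycenter identity. *)
Lemma closed_convex_Choquet B : B !=set0 -> B `<=` Lp -> convexS B ->
  clp B = B -> Choquet P p B.
Proof.
move=> B0 BL cB clB mu [C [mC CB _ muC _]] y [ly hy].
apply: contrapT => By.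
have [e e0 he] : exists2 e : R, 0 < e & forall b, B b -> (e%:E <= Lpd b y)%E.
  apply: contrapT => h; apply: By; rewrite -clB; split; first exact: ly.
  move=> e e0; apply: contrapT => h2; apply: h; exists e => // b Bb.
  by rewrite leNgt; apply/negP => lt; apply: h2; exists b.
(* [e] bounds the p-th power of the distance; its p-th root bounds the seminorm. *)
have ep0 : 0 < e `^ p^-1 by rewrite powR_gt0.
have dist_ge b : B b -> e `^ p^-1 <= Lpnorm P p (b - y).
  move=> Bb; rewrite leNgt; apply/negP => h.
  have := he _ Bb; rewrite leNgt => /negP; apply.
  have -> : e = (e `^ p^-1) `^ p by rewrite -powRrM mulVf ?gt_eqF// powRr1// ltW.
  by rewrite (Lpnorm_lt p1 ep0 (LpB sepE p1 (BL _ Bb) ly)) in h.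
have subL := Lp_subspace P sepE p1.
have [f [flin fN fB]] := seminorm_separation subL
  (fun v w lv lw => LpnormD sepE p1 lv lw) (fun a v lv => LpnormZ p1 a lv)
  BL B0 cB ly dist_ge.
have Vf : Vdual P p f.
  split; first exact: flin.
  move=> x lx e1 e10; exists (e1 `^ p); first by rewrite powR_gt0.
  move=> z lz xz.
  have lt_norm (u v : Omega -> E) : Lp u -> Lp v -> (Lpd u v < (e1 `^ p)%:E)%E -> f u - f v < e1.
    move=> lu lv uv; have luv := LpB sepE p1 lu lv.
    have -> : f u - f v = f (fun w => u w - v w).
      have := flin 1 (fun w => u w - v w) v luv lv; rewrite mul1r.
      have -> : 1 *: (fun w => u w - v w) + v = u.
        apply/funext => w; rewrite scale1r.
        by change (u w - v w + v w = u w); rewrite subrK.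
      by move=> ->; rewrite addrK.
    apply: le_lt_trans (fN _ luv) _.
    by rewrite (Lpnorm_lt p1 e10 luv).
  rewrite ltr_norml; apply/andP; split.
    by rewrite ltrNl opprB; exact: (lt_norm _ _ lx lz xz).
  by apply: (lt_norm _ _ lz lx); rewrite LpdC; exact: xz.
have [fint fint_eq] := hy f Vf.
have mL := measurable_Lp.
have CL : C `<=` Lp by exact: subset_trans CB BL.
have muLC : mu (Lp `\` C) = 0%E.
  apply/eqP; rewrite eq_le measure_ge0 andbT.
  have : (mu (~` C) = 0)%E by rewrite probability_setC// muC subee.
  by move=> <-; apply: le_measure; rewrite ?inE//; [exact: measurableD|exact: measurableC].
have := negligible_integral (measurableD mL mC) mL fint muLC.
rewrite fint_eq setDD (setIidr CL) => fyC.
have : (\int[mu]_(x in C) (f x)%:E <= \int[mu]_(x in C) (f y - e `^ p^-1)%:E)%E.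
  apply: le_integral => //.
  - exact: integrableS fint.
  - by apply: finite_measure_integrable_cst.
  move=> x /set_mem Cx; rewrite lee_fin.
  have := fB _ (CB _ Cx).
  have := flin 1 (x - y) y (LpB sepE p1 (CL _ Cx) ly) ly.
  by rewrite scale1r subrK mul1r; lra.
have -> : (\int[mu]_(x in C) (f y - e `^ p^-1)%:E)%E = (f y - e `^ p^-1)%:E.
  transitivity ((f y - e `^ p^-1)%:E * mu C)%E; first exact: integral_cst.
  by rewrite -[RHS]mule1; congr (_ * _)%E; exact: muC.
by rewrite -fyC lee_fin; lra.
Qed.

(** The a.s.-class of [x], expressed by distance zero. By [measurable_saturated] it cannot be split
    by a Borel set, so it plays the part of a point. *)
Definition same_class (x : Omega -> E) : set (Omega -> E) :=
  [set z | Lp z /\ Lpd z x = 0%E].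

Lemma same_class_refl x : Lp x -> same_class x x.
Proof. by move=> lx; split; [exact: lx|exact: Lpdxx]. Qed.

Lemma measurable_same_class x : Lp x -> measurable (same_class x : set VB).
Proof.
move=> lx.
have -> : same_class x = Lp `\` [set z | Lp z /\ Lpd z x <> 0%E].
  apply/seteqP; split=> z.
    by move=> [lz zx]; split => // -[].
  by move=> [lz h]; split => //; apply: contrapT => zx; exact: h.
apply: (@measurableD _ VB); first exact: measurable_Lp.
apply: measurable_Vopen; split => [z []//|z [lz zx]].
have zxy := Lpd_lty sepE p1 lz lx.
have e0 : 0 < fine (Lpd z x).
  by rewrite fine_gt0// zxy andbT lt_neqAle Lpd_ge0 andbT eq_sym; exact/eqP.
exists (fine (Lpd z x) / (2 * 2 `^ p)); split; first exact: quasi_eps.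
move=> y ly zy; split; first exact: ly.
move=> yx.
have := Lpd_triangle P sepE p1 (Lp_Emeas lz) (Lp_Emeas ly) (Lp_Emeas lx).
apply/negP; rewrite -ltNge -[ltRHS]fineK; last first.
  by rewrite ge0_fin_numE; [exact: zxy|exact: Lpd_ge0].
apply: quasi_lt; [exact: Lpd_ge0|exact: Lpd_ge0|exact: zy|].
by rewrite yx lte_fin; exact: quasi_eps.
Qed.

(** Open sets cannot distinguish functions at distance zero, and this property passes to the
    generated sigma-algebra. *)
Lemma measurable_saturated (B : set VB) x z : measurable B -> Lp x ->
  same_class x z -> (B x <-> B z).
Proof.
move=> mB lx xz; have [lz zx] := xz.
suff : <<s Vopen >> `<=` [set B : set (Omega -> E) | B x <-> B z] by exact.
apply: smallest_sub; last first.
  move=> O [OL Oopen]; split=> Oi; have [r [r0 hr]] := Oopen _ Oi; apply: hr => //.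
    by rewrite LpdC zx.
  by rewrite zx.
split => //=.
- by move=> U hU; split=> -[_ Ux]; split => // /hU.
- by move=> G hG; split=> -[n _ Gn]; exists n => //; apply/hG.
Qed.

(** Any open set containing [x] covers its whole class. The proposition [Q] lets one statement
    include the empty set, according to whether [x] belongs to a given Borel set. *)
Lemma Vcompact_and_same_class (Q : Prop) x : Lp x ->
  Vcompact P p [set z | Q /\ same_class x z].
Proof.
move=> lx; split=> [z [_ []]//|I O VO cov].
have [q|nq] := pselect Q; last first.
  exists 0%N, (fun k : 'I_0 => match notF (ltn_ord k) return I with end).
  by move=> z [].
have [i _ Oi] := cov x (conj q (same_class_refl lx)).
exists 1%N, (fun _ => i) => z [_ xz]; exists ord0 => //.
by apply/(measurable_saturated (measurable_Vopen (VO i)) lx xz).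
Qed.

Lemma VcompactU (K K' : set (Omega -> E)) :
  Vcompact P p K -> Vcompact P p K' -> Vcompact P p (K `|` K').
Proof.
move=> [KL hK] [KL' hK']; split=> [z [/KL|/KL']//|I O VO cov].
have [n [f fK]] := hK _ _ VO (subset_trans (@subsetUl _ _ _) cov).
have [n' [f' fK']] := hK' _ _ VO (subset_trans (@subsetUr _ _ _) cov).
exists (n + n')%N, (fun k => match fintype.split k with inl i => f i | inr i => f' i end).
have eL i : fintype.split (lshift n' i) = inl i := unsplitK (inl i).
have eR i : fintype.split (rshift n i) = inr i := unsplitK (inr i).
move=> z [/fK[i _ Oi]|/fK'[i _ Oi]].
  by exists (lshift n' i) => //; rewrite eL.
by exists (rshift n i) => //; rewrite eR.
Qed.

Lemma Vdual_measurable (l : (Omega -> E) -> R) : Vdual P p l ->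
  measurable_fun (Lp : set VB) (l : VB -> R).
Proof.
move=> [_ cl]; apply: (measurability _ (RGenOInfty.measurableE R)) => //.
move=> _ [_ [r ->] <-]; apply: measurable_Vopen.
split=> [z []//|z [lz]]; rewrite /= in_itv/= andbT => rz.
have [del del0 hdel] := cl z lz (l z - r) ltac:(by rewrite subr_gt0).
exists del; split => // y ly /(hdel _ ly); rewrite ltr_norml => /andP[h _].
split; first exact: ly.
rewrite /= in_itv/= andbT; lra.
Qed.

Section two_points.
Variables (t : R) (t0 : 0 <= t) (s0 : 0 <= 1 - t) (x y : Omega -> E).

Definition two_points : set VB -> \bar R := measure_add
  (mscale (NngNum t0) (@dirac _ VB x R)) (mscale (NngNum s0) (@dirac _ VB y R)).

HB.instance Definition _ := Measure.on two_points.

Lemma two_pointsE (B : set VB) :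
  two_points B = (t * \1_B x + (1 - t) * \1_B y)%:E.
Proof. by rewrite /two_points measure_addE /mscale /= /dirac. Qed.

Lemma two_points_setT : two_points setT = 1%E.
Proof. by rewrite two_pointsE !indicT !mulr1 addrC subrK. Qed.

HB.instance Definition _ :=
  Measure_isProbability.Build _ VB R two_points two_points_setT.

Let mu : probability VB R := two_points.

Lemma ge0_integral_two_points (D : set VB) (f : VB -> R) : measurable D ->
  D x -> D y -> measurable_fun D f -> (forall z, D z -> 0 <= f z) ->
  (\int[mu]_(z in D) (f z)%:E)%E = (t * f x + (1 - t) * f y)%:E.
Proof.
move=> mD Dx Dy mf f0.
have mfE : measurable_fun D (fun z => (f z)%:E) by exact/measurable_EFinP.
have f0E z : D z -> (0 <= (f z)%:E)%E by move=> /f0; rewrite lee_fin.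
transitivity (\int[mscale (NngNum t0) (@dirac _ VB x R)]_(z in D) (f z)%:E +
  \int[mscale (NngNum s0) (@dirac _ VB y R)]_(z in D) (f z)%:E)%E.
  exact: ge0_integral_measure_add.
rewrite !ge0_integral_mscale// !integral_dirac// !diracE !mem_set//.
by rewrite !mul1e.
Qed.

Lemma integral_two_points (D : set VB) (f : VB -> R) : measurable D ->
  D x -> D y -> measurable_fun D f ->
  mu.-integrable D (fun z => (f z)%:E) /\
  (\int[mu]_(z in D) (f z)%:E)%E = (t * f x + (1 - t) * f y)%:E.
Proof.
move=> mD Dx Dy mf.
have mfE : measurable_fun D (fun z => (f z)%:E) by exact/measurable_EFinP.
split.
  apply/integrableP; split; first exact: mfE.
  suff -> : (\int[mu]_(z in D) `|(f z)%:E|)%E = (t * `|f x| + (1 - t) * `|f y|)%:E.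
    by rewrite ltry.
  apply: (ge0_integral_two_points mD Dx Dy (f := fun z => `|f z|)) => //.
  exact: measurableT_comp.
rewrite integralE.
have -> : (\int[mu]_(z in D) ((fun z => (f z)%:E)^\+ z) =
    \int[mu]_(z in D) (Num.max (f z) 0)%:E)%E.
  by apply: eq_integral => z _; rewrite funeposE EFin_max.
have -> : (\int[mu]_(z in D) ((fun z => (f z)%:E)^\- z) =
    \int[mu]_(z in D) (Num.max (- f z) 0)%:E)%E.
  by apply: eq_integral => z _; rewrite funenegE EFin_max.
have m1 : measurable_fun D (fun z => Num.max (f z) 0).
  by apply: measurable_maxr => //; exact: measurable_cst.
have m2 : measurable_fun D (fun z => Num.max (- f z) 0).
  by apply: measurable_maxr; [exact: measurableT_comp|exact: measurable_cst].
rewrite (ge0_integral_two_points mD Dx Dy m1); last by move=> z _; rewrite le_max lexx orbT.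
rewrite (ge0_integral_two_points mD Dx Dy m2); last by move=> z _; rewrite le_max lexx orbT.
have maxE (a : R) : Num.max a 0 - Num.max (- a) 0 = a.
  by case: (leP a 0) => a0; [rewrite max_l; lra|rewrite max_r; lra].
rewrite -EFinB; congr EFin.
by rewrite -[in RHS](maxE (f x)) -[in RHS](maxE (f y)); lra.
Qed.

End two_points.

Lemma Choquet_convexS B : saturated P p B -> Choquet P p B -> convexS B.
Proof.
move=> [BL satB] cB x y t Bx By /andP[t0 t1].
have s0 : 0 <= 1 - t by rewrite subr_ge0.
have lx := BL _ Bx; have ly := BL _ By.
have mL := measurable_Lp.
pose mu : probability VB R := two_points t0 s0 x y.
have bary : Vbary mu (t *: x + (1 - t) *: y).
  split; first by apply: (convexS_Lp sepE p1 lx ly); exact/andP.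
  move=> l Vl.
  have [h1 h2] := integral_two_points t0 s0 mL lx ly (Vdual_measurable Vl).
  split; [exact: h1|rewrite h2; congr EFin].
  have l0 : l 0 = 0.
    have L0 := (Lp_subspace P sepE p1).1.
    by have := Vl.1 1 0 0 L0 L0; rewrite scaler0 addr0 mul1r; lra.
  have := Vl.1 (1 - t) y 0 ly (Lp_subspace P sepE p1).1.
  rewrite addr0 l0 addr0 => <-.
  by rewrite (Vl.1 t x _ lx (LpZ sepE (1 - t) ly)).
apply: (cB mu) => //.
(* The pair of functions need not be measurable; the union of their classes is, and saturation
   places it in [B]. *)
exists (same_class x `|` same_class y : set VB); split; last by eexists; exact: bary.
- by apply: (@measurableU _ VB); exact: measurable_same_class.
- move=> z [[lz zx]|[lz zx]]; [apply: (satB _ _ Bx lz)|apply: (satB _ _ By lz)].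
    exact: (Lpd_eq0 sepE (Lp_Emeas lx) (Lp_Emeas lz) (etrans (LpdC _ _ _ _) zx)).
  exact: (Lpd_eq0 sepE (Lp_Emeas ly) (Lp_Emeas lz) (etrans (LpdC _ _ _ _) zx)).
- move=> C mC; apply/eqP; rewrite eq_le; apply/andP; split; last first.
    apply: ge_ereal_sup => _ [K [mK _ KC] <-].
    by apply: le_measure => //; rewrite inE.
  (* [K] joins the classes of those of [x] and [y] that lie in [C]: compact, contained in [C], and
     of the same mass, so regularity holds with an attained supremum. *)
  pose K : set VB := [set z | C x /\ same_class x z] `|` [set z | C y /\ same_class y z].
  have KC : K `<=` C.
    by move=> z [[Cx xz]|[Cy yz]]; [exact/(measurable_saturated mC lx xz)|
      exact/(measurable_saturated mC ly yz)].
  have -> : mu C = mu K.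
    rewrite /mu /= !two_pointsE !indicE.
    have -> : (x \in C) = (x \in K).
      apply/idP/idP => /set_mem h; apply/mem_set; last exact: KC.
      by left; split => //; exact: same_class_refl.
    have -> // : (y \in C) = (y \in K).
    apply/idP/idP => /set_mem h; apply/mem_set; last exact: KC.
    by right; split => //; exact: same_class_refl.
  apply: ereal_sup_ubound; exists K => //; split => //.
  + by apply: (@measurableU _ VB); apply: (@measurable_and_cst _ VB); exact: measurable_same_class.
  + by apply: VcompactU; exact: Vcompact_and_same_class.
- rewrite /mu /= two_pointsE !indicE !mem_set;
    [|by right; exact: same_class_refl|by left; exact: same_class_refl].
  by rewrite !mulr1 addrC subrK.
Qed.

End Choquet_sets.

(** * Closed convex hulls of multifunctions *)

Lemma closure_convex (R : realType) (E : normedModType R) (S : set E) :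
  convexS S -> convexS (closure S).
Proof.
move=> cS x y t /closure_norm hx /closure_norm hy /andP[t0 t1].
apply/closure_norm => e e0.
have e20 : 0 < e / 2 by rewrite divr_gt0.
have [x' Sx xx] := hx _ e20; have [y' Sy yy] := hy _ e20.
exists (t *: x' + (1 - t) *: y'); first by apply: cS => //; exact/andP.
have -> : t *: x + (1 - t) *: y - (t *: x' + (1 - t) *: y') =
    t *: (x - x') + (1 - t) *: (y - y').
  by rewrite !scalerBr addrACA -opprD.
apply: le_lt_trans (ler_normD _ _) _; rewrite !normrZ !ger0_norm ?subr_ge0//.
have : t * `|x - x'| <= `|x - x'| by rewrite ler_piMl.
have : (1 - t) * `|y - y'| <= `|y - y'| by rewrite ler_piMl// lerBlDr lerDl.
lra.
Qed.

Section convex_hull_of_multifunction.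
Variables (R : realType) (E : completeNormedModType R) (d : measure_display)
  (Omega : measurableType d) (P : probability Omega R) (p : R).
Hypothesis sepE : separable E.
Hypothesis p1 : 1 <= p.
Implicit Types (A B : set (Omega -> E)) (F X : Omega -> set E).
Local Notation Lp := (@Lp R E d Omega P p).
Local Notation Lpd := (Lpd P p).
Local Notation clp := (clp P p).
Local Notation LpX := (@LpX R E d Omega P p).

Lemma LpX_Lp X : LpX X `<=` Lp.
Proof. by move=> x []. Qed.

Lemma Lpd_markov (N : set Omega) x y (c : R) : measurable N -> Lp x -> Lp y ->
  0 <= c -> (forall w, N w -> c <= `|x w - y w|) ->
  ((c `^ p)%:E * P N <= Lpd x y)%E.
Proof.
move=> mN lx ly c0 hN.
have mI : measurable_fun setT (fun w => (\1_N w)%:E : \bar R).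
  by apply/measurable_EFinP; exact: measurable_indic.
have I0 w : setT w -> (0 <= (\1_N w)%:E :> \bar R)%E by rewrite lee_fin indicE.
have mxy := measurable_pnorm p (EmeasB sepE (Lp_Emeas lx) (Lp_Emeas ly)).
have -> : P N = (\int[P]_w (\1_N w)%:E)%E by rewrite integral_indic// setIT.
rewrite -(ge0_integralZl_EFin P measurableT I0 mI (powR_ge0 c p)) LpdE.
apply: (ge0_le_integral P measurableT _ _ mxy).
- by move=> w Tw; rewrite mule_ge0 ?I0// lee_fin powR_ge0.
- exact: measurable_funeM.
move=> w _; rewrite -EFinM lee_fin indicE.
have [Nw|Nw] := pselect (N w); last by rewrite memNset// mulr0 powR_ge0.
by rewrite mem_set// mulr1; apply: (powR_le_norm p1 c0); exact: hN.
Qed.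

(** The points where all [x n] stay 1/(k+1) away from [y] form a null set, by Markov's inequality
    for every [n]. Hence almost every [y w] is a limit point of values in [X w], without passing to
    an a.s. convergent subsequence. *)
Lemma clp_LpX X : closed_valued X -> clp (LpX X) `<=` LpX X.
Proof.
move=> cX y [ly hy]; split; first exact: ly.
have /choice[x hx] : forall n : nat, exists x, LpX X x /\ (Lpd x y < (n.+1%:R^-1)%:E)%E.
  move=> n; have n0 : 0 < n.+1%:R^-1 :> R by rewrite invr_gt0.
  by have [x Xx xy] := hy _ n0; exists x.
have lx n : Lp (x n) by have [[]] := hx n.
have ae1 : {ae P, forall w, forall k : nat, ~ (forall n, k.+1%:R^-1 <= `|x n w - y w|)}.
  apply: ae_foralln => k.
  set N := [set w | forall n, k.+1%:R^-1 <= `|x n w - y w|].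
  have mN : measurable N.
    apply: measurable_forall => n; apply: measurable_le_set => //.
    exact: (Emeas_norm (EmeasB sepE (Lp_Emeas (lx n)) (Lp_Emeas ly))).
  have k0 : 0 < k.+1%:R^-1 :> R by rewrite invr_gt0.
  have c0 : 0 < k.+1%:R^-1 `^ p by rewrite powR_gt0.
  exists N; split => // [|w /= /contrapT//].
  have PNE : (fine (P N))%:E = P N by rewrite fineK// fin_num_measure.
  have PN0 : fine (P N) <= 0.
    rewrite leNgt; apply/negP => PN0.
    have [n] := invS_lt (mulr_gt0 c0 PN0); apply/negP; rewrite -leNgt.
    have := Lpd_markov mN (lx n) ly (ltW k0) (fun w Nw => Nw n).
    move=> /le_lt_trans/(_ (hx n).2); rewrite -PNE -EFinM lte_fin.
    exact: ltW.
  suff PN00 : P N = 0%E by exact: PN00.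
  by rewrite -PNE; congr EFin; apply/eqP; rewrite eq_le PN0 fine_ge0.
have ae2 : {ae P, forall w, forall n, X w (x n w)}.
  by apply: ae_foralln => n; have [[]] := hx n.
apply: filterS2 ae1 ae2 => w h1 h2.
rewrite ((closure_id (X w)).1 (cX w)); apply/closure_norm => e e0.
have [k ke] := invS_lt e0.
have [n xn] : exists n, `|x n w - y w| < k.+1%:R^-1.
  apply: contrapT => nn; apply: (h1 k) => n.
  by rewrite leNgt; apply/negP => xn; apply: nn; exists n.
by exists (x n w); [exact: h2|rewrite distrC (lt_trans xn)].
Qed.

Lemma LpX_decomposable X : decomposable (LpX X).
Proof.
move=> B x y mB [lx hx] [ly hy]; split; first exact: (Lp_splice p1 mB lx ly).
by apply: filterS2 hx hy => w Xx Xy; rewrite /splice; case: ifP.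
Qed.

Lemma LpX_convex X : (forall w, convexS (X w)) -> convexS (LpX X).
Proof.
move=> cX x y t [lx hx] [ly hy] t01; split; first exact: (convexS_Lp sepE p1 lx ly t01).
by apply: filterS2 hx hy => w Xx Xy; exact: cX.
Qed.

Lemma LpX_mono X F : {ae P, forall w, X w `<=` F w} -> LpX X `<=` LpX F.
Proof. by move=> XF x [lx hx]; split => //; apply: filterS2 XF hx => w; apply. Qed.

(* Convexity of the values is recovered from countably many convex
   combinations: pairs of the Castaing representation with weights a/(n+1). *)
Lemma convex_values_ae (h : nat -> Omega -> E) :
  convexS (LpX (fun w => closure (range (fun n => h n w)))) ->
  (forall n, LpX (fun w => closure (range (fun n => h n w))) (h n)) ->
  {ae P, forall w, convexS (closure (range (fun n => h n w)))}.
Proof.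
move=> cG Gh; set G := fun w => closure (range (fun n => h n w)).
have : {ae P, forall w, forall i j a n : nat, (a <= n.+1)%N ->
    G w ((a%:R / n.+1%:R) *: h i w + (1 - a%:R / n.+1%:R) *: h j w)}.
  apply: ae_foralln => i; apply: ae_foralln => j.
  apply: ae_foralln => a; apply: ae_foralln => n.
  have [an|an] := leqP a n.+1; last exact: aeW.
  have an01 : 0 <= (a%:R / n.+1%:R : R) <= 1.
    by rewrite divr_ge0// ler_pdivrMr// mul1r ler_nat.
  have [_] := cG _ _ _ (Gh i) (Gh j) an01.
  by apply: filterS => w Gw _; exact: Gw.
apply: filterS => w hw x y t Gx Gy /andP[t0 t1].
move/closure_norm : (Gx) => hx; move/closure_norm : (Gy) => hy.
suff : closure (G w) (t *: x + (1 - t) *: y).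
  by rewrite -((closure_id (G w)).1 (@closed_closure _ _)).
apply/closure_norm => e e0.
have e30 : 0 < e / 3 by rewrite divr_gt0.
have c0 : 0 < `|x - y| + 1 by rewrite ltr_wpDl.
(* Three errors share [e]: replacing the weight [t] by its truncation [s], which costs at most |x -
   y|/(n+1), and approximating [x] and [y] by terms of [h]. *)
have [n hn] := invS_lt (divr_gt0 e30 c0).
have [_ [i _ <-] xi] := hx _ e30; have [_ [j _ <-] yj] := hy _ e30.
pose a := Num.truncn (t * n.+1%:R).
have tn0 : 0 <= t * n.+1%:R by rewrite mulr_ge0.
have /andP[a1 a2] := truncn_itv tn0.
have an : (a <= n.+1)%N.
  by rewrite -(ler_nat R) (le_trans a1)// ler_piMl.
pose s : R := a%:R / n.+1%:R.
have st : s <= t by rewrite ler_pdivrMr.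
have ts : t - s < n.+1%:R^-1.
  by rewrite ltrBlDl -[X in _ + X]div1r -mulrDl ltr_pdivlMr// natr1.
have s0 : 0 <= s by rewrite divr_ge0.
have s1 : s <= 1 by exact: le_trans st t1.
exists (s *: h i w + (1 - s) *: h j w); first exact: hw.
clear hw; clearbody s.
have -> : t *: x + (1 - t) *: y - (s *: h i w + (1 - s) *: h j w) =
    (t - s) *: (x - y) + (s *: (x - h i w) + (1 - s) *: (y - h j w)).
  have -> : t *: x + (1 - t) *: y = (t - s) *: (x - y) + (s *: x + (1 - s) *: y).
    rewrite scalerBr addrACA -scalerDl subrK -scaleNr -scalerDl.
    by congr (_ + _ *: _); lra.
  by rewrite -addrA; congr (_ + _); rewrite !scalerBr addrACA -opprD.
apply: le_lt_trans (ler_normD _ _) _.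
have h1 : `|(t - s) *: (x - y)| < e / 3.
  rewrite normrZ ger0_norm ?subr_ge0//.
  have := ler_wpM2r (normr_ge0 (x - y)) (ltW ts).
  have u0 : 0 < n.+1%:R^-1 :> R by rewrite invr_gt0.
  by move: hn u0; rewrite ltr_pdivlMr//; set u := n.+1%:R^-1; lra.
have h2 := ler_normD (s *: (x - h i w)) ((1 - s) *: (y - h j w)).
rewrite !normrZ !ger0_norm ?subr_ge0// in h2.
have h3 : s * `|x - h i w| <= `|x - h i w| by rewrite ler_piMl.
have h4 : (1 - s) * `|y - h j w| <= `|y - h j w| by rewrite ler_piMl// lerBlDr lerDl.
lra.
Qed.

Lemma LpX_cconvE F : closed_valued F -> effros F -> LpX F !=set0 ->
  LpX (fun w => cconvE (F w)) = clp (convS (LpX F)).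
Proof.
move=> cF eF [z Fz].
have FL : LpX F `<=` Lp by exact: LpX_Lp.
have cL := convS_Lp sepE p1 FL.
set M := clp (convS (LpX F)).
have ML : M `<=` Lp by exact: clp_Lp.
have FM : LpX F `<=` M.
  by apply: subset_trans (sub_clp p1 cL); exact: sub_convS.
(* This inclusion holds because the left-hand side is closed, convex and contains [LpX F]; the other
   one uses the representation of [M]. *)
apply/seteqP; split; last first.
  apply: subset_trans (clp_mono _) (clp_LpX _); last by move=> w; exact: closed_closure.
  apply: convS_min.
    apply: LpX_mono; apply: aeW => w x Fx.
    by apply: subset_closure; exact: sub_convS.
  by apply: LpX_convex => w; apply: closure_convex; exact: convS_convex.
have dM : decomposable M.
  by apply: (clp_decomposable sepE p1 cL); apply: convS_decomposable; exact: LpX_decomposable.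
have cM : convexS M by apply: (clp_convex sepE p1 cL); exact: convS_convex.
have M0 : M !=set0 by exists z; exact: FM.
have [h [Mh MG]] := decomposable_closed_LpX sepE p1 ML dM M0 (clp_idem sepE p1 cL).
rewrite MG; apply: LpX_mono.
have FG : {ae P, forall w, F w `<=` closure (range (fun n => h n w))}.
  have hF := effros_sub_closure sepE p1 cF eF (fun n => ML _ (Mh n)) (ex_intro _ z Fz).
  by apply: hF; rewrite -MG; exact: FM.
have cG : {ae P, forall w, convexS (closure (range (fun n => h n w)))}.
  by apply: convex_values_ae; [rewrite -MG|move=> n; rewrite -MG].
apply: filterS2 FG cG => w FGw cGw.
rewrite [X in _ `<=` X]((closure_id _).1 (@closed_closure _ _)).
by apply: closure_subset; exact: convS_min.
Qed.

(** * Comparison of the Choquet, decomposable and convex hulls *)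

Lemma chd_convex_Choquet A : A `<=` Lp -> A !=set0 -> convexS A ->
  Choquet P p (chd P p A).
Proof.
move=> AL [z Az] cA; have dL := dec_Lp p1 AL.
rewrite (chdE sepE p1 AL); last by exists z.
apply: (closed_convex_Choquet sepE p1 _ (@clp_Lp _ _ _ _ _ _ _) _ (clp_idem sepE p1 dL)).
  by exists z; apply: (sub_clp p1 dL); exact: sub_dec.
by apply: (clp_convex sepE p1 dL); exact: convexS_dec.
Qed.

(** [Lp] itself is an admissible set in the intersection: barycenters lie in it by definition. *)
Lemma ch_Lp A : A `<=` Lp -> ch P p A `<=` Lp.
Proof.
move=> AL x; apply => //; first by split.
by move=> mu _ y [].
Qed.

Lemma convS_sub_ch A : convS A `<=` ch P p A.
Proof.
move=> x cx B sB AB cB; have cvB := Choquet_convexS sepE p1 sB cB.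
exact: (convS_min AB cvB).
Qed.

(** The closure of [dec (convS A)] is itself a saturated Choquet set containing [A], hence contains
    [ch P p A]; being closed and decomposable, it absorbs the larger hull. *)
Lemma chd_ch A : A `<=` Lp -> A !=set0 -> chd P p (ch P p A) = chd P p (convS A).
Proof.
move=> AL [z Az]; have cvL := convS_Lp sepE p1 AL; have dL := dec_Lp p1 cvL.
have cvz : convS A z by exact: sub_convS.
have chz : ch P p A z by exact: convS_sub_ch.
have cv0 : convS A !=set0 by exists z.
have chdcv := chdE sepE p1 cvL cv0.
rewrite (chdE sepE p1 (ch_Lp AL)); last by exists z.
rewrite chdcv; apply/seteqP; split; last first.
  by apply: clp_mono; apply: dec_mono; [exists z|exact: convS_sub_ch].
rewrite -[X in _ `<=` X](clp_idem sepE p1 dL); apply: clp_mono.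
have decz : clp (dec (convS A)) z by apply: (sub_clp p1 dL); exact: sub_dec.
apply: dec_min; first by exists z.
- move=> x; apply.
  + exact: (clp_saturated sepE p1 dL).
  + by move=> y Ay; apply: (sub_clp p1 dL); apply: sub_dec; exact: sub_convS.
  + rewrite -chdcv; apply: chd_convex_Choquet => //; exact: convS_convex.
- by apply: (clp_decomposable sepE p1 dL); exact: dec_decomposable.
Qed.

Lemma clp_convS_clp A : A `<=` Lp -> clp (convS (clp A)) = clp (convS A).
Proof.
move=> AL; have cL := convS_Lp sepE p1 AL; apply/seteqP; split; last first.
  by apply: clp_mono; apply: convS_mono; exact: sub_clp.
rewrite -[X in _ `<=` X](clp_idem sepE p1 cL); apply: clp_mono; apply: convS_min.
  by apply: clp_mono; exact: sub_convS.
by apply: (clp_convex sepE p1 cL); exact: convS_convex.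
Qed.

End convex_hull_of_multifunction.

Theorem mainTheorem11 (R : realType) (E : completeNormedModType R)
  (d : measure_display) (Omega : measurableType d) (P : probability Omega R)
  (p : R) :
  separable E ->
  (forall N : set Omega, P.-negligible N -> measurable N) ->
  1 <= p ->
  (forall C : set (Omega -> E), saturated P p C -> C !=set0 -> convexS C ->
     Choquet P p (chd P p C)) /\
  (forall (A : set (Omega -> E)) (F : Omega -> set E),
     saturated P p A -> A !=set0 -> isFA P p A F ->
     chd P p (ch P p A) = chd P p (convS A) /\
     chd P p (convS A) = LpX P p (fun w => cconvE (F w)) /\
     LpX P p (fun w => cconvE (F w)) = clp P p (convS (LpX P p F)) /\
     clp P p (convS (LpX P p F)) = clp P p (convS (chd P p A)) /\
     clp P p (convS (chd P p A)) = clp P p (convS (dec A)) /\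
     clp P p (convS (dec A)) = clp P p (dec (convS A))).
Proof.
move=> sepE _ p1; split=> [C [CL _] C0 cC|A F [AL _] [z Az] [cF eF FE]].
  exact: chd_convex_Choquet.
have A0 : A !=set0 by exists z.
have dL := dec_Lp p1 AL.
have F0 : LpX P p F !=set0.
  by exists z; rewrite -FE; apply: (sub_clp p1 dL); exact: sub_dec.
have cv0 : convS A !=set0 by exists z; exact: sub_convS.
have chdA := chdE sepE p1 AL A0.
have chdcv := chdE sepE p1 (convS_Lp sepE p1 AL) cv0.
have cconvF := LpX_cconvE sepE p1 cF eF F0.
have convdec := convS_dec A0.
have convclp := clp_convS_clp sepE p1 dL.
split; first exact: chd_ch.
split; first by rewrite chdcv cconvF -FE convclp convdec.
split; first exact: cconvF.
split; first by rewrite chdA FE.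
split; first by rewrite chdA.
by rewrite convdec.
Qed.
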